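(* Let $X$ be an infinite-dimensional complex Banach space and $T\in L(X)$. Then for each $\mathbf R$ among $\mathcal B_+$, $\mathcal B_-$, $\mathcal B$, $\Phi_+$, $\Phi_-$, $\Phi$, $\mathcal W_+$, $\mathcal W_-$, $\mathcal W$, $$\partial\sigma_{\mathbf R}(T)\cap\operatorname{acc}\sigma_{\mathbf R}(T)\subset\sigma_{gKR}(T),$$ and moreover $$\partial\sigma_{ap}(T)\cap\operatorname{acc}\sigma_{\mathcal B_+}(T)\subset\sigma_{gKR}(T),\quad \partial\sigma_{su}(T)\cap\operatorname{acc}\sigma_{\mathcal B_-}(T)\subset\sigma_{gKR}(T),\quad \partial\sigma(T)\cap\operatorname{acc}\sigma_{\mathcal B}(T)\subset\sigma_{gKR}(T).$$
   Context: $S$ is Kato if $R(S)$ is closed and $N(S)\subset R(S^n)$ for all $n$; $S$ is Riesz if $S-\lambda$ is Fredholm for all $\lambda\ne0$. $\sigma_{gKR}(T)$ is the set of $\lambda\in\mathbb C$ for which there are no closed $(T-\lambda)$-invariant $M,N$ with $X=M\oplus N$, $(T-\lambda)_M$ Kato and $(T-\lambda)_N$ Riesz. $\Phi_+$: finite-dimensional kernel and closed range; $\Phi_-$: finite-codimensional range; $\Phi=\Phi_+\cap\Phi_-$; $\mathcal W_+$, $\mathcal W_-$, $\mathcal W$: operators in $\Phi_+$, $\Phi_-$, $\Phi$ with index $\le0$, $\ge0$, $=0$; $\mathcal B_+$: $\Phi_+$ with finite ascent; $\mathcal B_-$: $\Phi_-$ with finite descent; $\mathcal B$: Fredholm with finite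 ascent and descent. $\sigma_{\mathbf R}(T)=\{\lambda:T-\lambda\notin\mathbf R\}$; $\sigma_{ap}(T)$ ($\sigma_{su}(T)$): $T-\lambda$ not bounded below (not surjective). $\partial$, $\operatorname{acc}$: boundary, accumulation points. *)

(* Defs.v *)
From HB Require Import structures.
From mathcomp Require Import all_boot all_order all_algebra.
From mathcomp Require Import all_classical all_reals topology normedtype.
From mathcomp Require Import complex.
Export numFieldNormedType.Exports.

Set Implicit Arguments.
Unset Strict Implicit.
Unset Printing Implicit Defensive.

Import Order.TTheory GRing.Theory Num.Theory.
Local Open Scope ring_scope.
Local Open Scope classical_set_scope.
Local Open Scope complex_scope.

Section OperatorTheory.
Variable R : realType.
Variable X : completeNormedModType R[i].
Implicit Types (M A : set X) (S : X -> X) (n : nat).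

Definition span (s : seq X) : set X :=
  [set x | exists c : 'I_(size s) -> R[i], x = \sum_(i < size s) c i *: s`_i].

Definition is_subspace M : Prop :=
  M 0 /\ (forall x y, M x -> M y -> M (x + y)) /\
  (forall (a : R[i]) x, M x -> M (a *: x)).

Definition dim_le A n : Prop :=
  exists s : seq X, size s = n /\ A `<=` span s.
Definition findim A : Prop := exists n, dim_le A n.
Definition dimn A : nat :=
  xget 0%N [set n | dim_le A n /\ forall k, dim_le A k -> (n <= k)%N].

Definition codim_le M A n : Prop :=
  exists s : seq X, size s = n /\
    forall x, M x -> exists a v, A a /\ span s v /\ x = a + v.
Definition fincodim M A : Prop := exists n, codim_le M A n.
Definition codimn M A : nat :=
  xget 0%N [set n | codim_le M A n /\ forall k, codim_le M A k -> (n <= k)%N].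

(* Notions for the restriction S_M of S to an S-invariant closed subspace M:
   N(S_M) = M `&` ker S,  R(S_M) = S @` M,  (S_M)^n = (iter n S)_M. *)
Definition kerM M S : set X := M `&` [set x | S x = 0].
Definition rngM M S : set X := S @` M.

Definition Phi_plus M S : Prop := findim (kerM M S) /\ closed (rngM M S).
Definition Phi_minus M S : Prop := fincodim M (rngM M S).
Definition Fredholm M S : Prop := Phi_plus M S /\ Phi_minus M S.
Definition index M S : int := (dimn (kerM M S))%:Z - (codimn M (rngM M S))%:Z.
(* index <= 0 (index = -oo allowed when the range has infinite codimension) *)
Definition Weyl_plus M S : Prop :=
  Phi_plus M S /\ (fincodim M (rngM M S) -> index M S <= 0).
(* index >= 0 (index = +oo allowed when the kernel is infinite-dimensional) *)
Definition Weyl_minus M S : Prop :=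
  Phi_minus M S /\ (findim (kerM M S) -> 0 <= index M S).
Definition Weyl M S : Prop := Fredholm M S /\ index M S = 0.
Definition finite_ascent M S : Prop :=
  exists p, kerM M (iter p S) = kerM M (iter p.+1 S).
Definition finite_descent M S : Prop :=
  exists q, rngM M (iter q S) = rngM M (iter q.+1 S).
Definition Browder_plus M S : Prop := Phi_plus M S /\ finite_ascent M S.
Definition Browder_minus M S : Prop := Phi_minus M S /\ finite_descent M S.
Definition Browder M S : Prop :=
  Fredholm M S /\ finite_ascent M S /\ finite_descent M S.

Definition shift S (l : R[i]) : X -> X := fun x => S x - l *: x.

Definition Kato M S : Prop :=
  closed (rngM M S) /\ forall n, kerM M S `<=` rngM M (iter n S).
Definition Riesz M S : Prop :=
  forall l : R[i], l != 0 -> Fredholm M (shift S l).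

Definition invariant M S : Prop := forall x, M x -> M (S x).

Definition sigma_gKR S : set (R[i])^o :=
  [set l | ~ exists M N : set X,
      is_subspace M /\ is_subspace N /\ closed M /\ closed N /\
      invariant M (shift S l) /\ invariant N (shift S l) /\
      M `&` N = [set 0] /\ (forall x : X, exists (m y : X), M m /\ N y /\ x = m + y) /\
      Kato M (shift S l) /\ Riesz N (shift S l)].

Inductive opclass :=
  | cB_plus | cB_minus | cB | cPhi_plus | cPhi_minus | cPhi
  | cW_plus | cW_minus | cW.

Definition inclass (c : opclass) : set X -> (X -> X) -> Prop :=
  match c with
  | cB_plus => Browder_plus | cB_minus => Browder_minus | cB => Browder
  | cPhi_plus => Phi_plus | cPhi_minus => Phi_minus | cPhi => Fredholm
  | cW_plus => Weyl_plus | cW_minus => Weyl_minus | cW => Weyl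
  end.

Definition sigma_cls (c : opclass) S : set (R[i])^o :=
  [set l | ~ inclass c setT (shift S l)].

Definition bounded_below S : Prop :=
  exists c : R[i], 0 < c /\ forall x, c * `|x| <= `|S x|.
Definition sigma_ap S : set (R[i])^o := [set l | ~ bounded_below (shift S l)].
Definition sigma_su S : set (R[i])^o :=
  [set l | ~ (forall y, exists x, shift S l x = y)].
Definition invertible S : Prop :=
  exists U : X -> X, continuous U /\ (forall x, U (S x) = x) /\ (forall x, S (U x) = x).
Definition spectrum S : set (R[i])^o := [set l | ~ invertible (shift S l)].

Definition infinite_dimensional : Prop := ~ findim [set: X].

End OperatorTheory.

Definition boundary (R : realType) (A : set (R[i])^o) : set (R[i])^o :=
  closure A `\` interior A.

(* Main.v *)
Require Import Defs.
From HB Require Import structures.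
From mathcomp Require Import all_boot all_order all_algebra.
From mathcomp Require Import all_classical all_reals topology normedtype.
From mathcomp Require Import complex ring lra.
Require Import Defs.
Import numFieldNormedType.Exports.
Import Order.TTheory GRing.Theory Num.Theory.
Set Implicit Arguments.
Unset Strict Implicit.
Unset Printing Implicit Defensive.
Local Open Scope ring_scope.
Local Open Scope classical_set_scope.
Local Open Scope complex_scope.

(** After a shift the point is [0], and [X] is the direct sum of [M] and [N] with [S_M] Kato and
    [S_N] Riesz.  For small [l], the kernels (and the ranges) of [S_M] and [S_M - l] are close in
    the sense of the gap, so that they have the same dimension (codimension); a Kato operator of
    finite ascent is injective and one of finite descent is surjective, so each of the nine
    classes contains all the [S_M - l] or none of them.  On the other summand, [S_N - l] is
    Browder of index [0] for every [l != 0]: a semi-Fredholm operator is Kato on [R(S_N^n)] for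
    large [n], hence near every [l != 0] the operators [S_N - m], [m != l], are all bijective or
    all non-bijective, and connectedness of the ray from [l] to infinity decides for "bijective".
    The same holds for [l = 0] as soon as [S_N] is semi-Fredholm.  Therefore, if one [S - l] with
    [l] small (possibly [0]) is in a class, all the others with [l != 0] are too. *)

(** * Real-valued norms *)

(** Dimension is codimension of [[set 0]], so that nullity and deficiency obey the same lemmas.
    Quotient spaces are replaced by chosen preimages ([range_bound]), and duality by inductions that
    adjoin one vector at a time ([addline]). The gap lemma compares codimensions only up to a
    prescribed [k], with a width that shrinks as [k] grows, whereas one radius must serve for all
    [k]. It is recovered because the Kato property survives a shift with its constant enlarged by at
    most 5, which permits many tiny steps. In the end, a boundary point has points outside the
    spectrum arbitrarily near, possibly itself, and an accumulation point has other spectral points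
    arbitrarily near; a decomposition at that point would make the two contradict each other. *)

Section RealNorm.
Variable R : realType.

(* The norms of the library take values in [R[i]]; [md] and [nrm] are their real-valued versions. *)
Definition md (a : R[i]) : R := complex.Re `|a|.

Lemma mdE a : `|a| = (md a)%:C.
Proof. by rewrite /md RRe_real // ger0_real ?normr_ge0. Qed.

Lemma md_ge0 a : 0 <= md a.
Proof. by rewrite -lecR -mdE normr_ge0. Qed.

Lemma md0 : md 0 = 0.
Proof. by rewrite /md normr0. Qed.

Lemma md_gt0 a : a != 0 -> 0 < md a.
Proof. by move=> a0; rewrite -ltcR -mdE normr_gt0. Qed.

Lemma mdD a b : md (a + b) <= md a + md b.
Proof. by rewrite -lecR rmorphD /= -!mdE ler_normD. Qed.

Lemma mdN a : md (- a) = md a.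
Proof. by rewrite /md normrN. Qed.

Lemma mdM a b : md (a * b) = md a * md b.
Proof. by apply/complexI; rewrite rmorphM /= -!mdE normrM. Qed.

Lemma mdV a : md a^-1 = (md a)^-1.
Proof. by apply/complexI; rewrite fmorphV /= -!mdE normfV. Qed.

Lemma md_real (a : R) : md a%:C = `|a|.
Proof. by rewrite /md normc_def /= expr0n addr0 sqrtr_sqr. Qed.

Lemma md_i : md 'i%C = 1.
Proof. by rewrite /md normc_def /= expr0n add0r expr1n sqrtr1. Qed.

Lemma Re_md (a : R[i]) : `|complex.Re a| <= md a.
Proof. by rewrite -lecR -mdE normc_ge_Re. Qed.

Lemma Im_md (a : R[i]) : `|complex.Im a| <= md a.
Proof. by have := Re_md (a * 'i%C); rewrite mdM md_i mulr1 ReiNIm normrN. Qed.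

Lemma md_ReIm (a : R[i]) : md a <= `|complex.Re a| + `|complex.Im a|.
Proof.
by rewrite [a in md a]complexE; apply: le_trans (mdD _ _) _; rewrite mdM !md_real md_i mul1r.
Qed.

Lemma gtc0_real (e : R[i]) : 0 < e -> e = (complex.Re e)%:C /\ 0 < complex.Re e.
Proof.
move=> e0; have er : e = (complex.Re e)%:C by rewrite RRe_real // gtr0_real.
by split => //; rewrite -ltcR -er.
Qed.

Lemma gtc0E (e : R) : (0 < e%:C) = (0 < e).
Proof. by rewrite (_ : 0 = 0%:C) // ltcR. Qed.

Lemma nbhs_mdP (x : (R[i])^o) (P : set (R[i])^o) :
  nbhs x P <-> exists2 e : R, 0 < e & forall y : R[i], md (y - x) < e -> P y.
Proof.
split.
  move=> /(@nbhs_normP _ (R[i])^o) [e /gtc0_real [-> e0] h]; exists (complex.Re e) => // y hy.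
  by apply: h; rewrite /ball_ /= distrC mdE ltcR.
move=> [e e0 h]; apply/(@nbhs_normP _ (R[i])^o); exists e%:C; first by rewrite /= gtc0E.
by move=> y; rewrite /ball_ /= distrC mdE ltcR; apply: h.
Qed.

Variable X : completeNormedModType R[i].
Implicit Types x y : X.

Definition nrm (x : X) : R := complex.Re `|x|.

Lemma nrmE x : `|x| = (nrm x)%:C.
Proof. by rewrite /nrm RRe_real // ger0_real ?normr_ge0. Qed.

Lemma nrm_ge0 x : 0 <= nrm x.
Proof. by rewrite -lecR -nrmE normr_ge0. Qed.

Lemma nrm0 : nrm (0 : X) = 0.
Proof. by rewrite /nrm normr0. Qed.

Lemma nrm_eq0 x : nrm x = 0 -> x = 0.
Proof. by move=> h; apply/eqP; rewrite -normr_eq0 nrmE h. Qed.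

Lemma nrm_gt0 x : x <> 0 -> 0 < nrm x.
Proof.
move=> h; rewrite lt_neqAle nrm_ge0 andbT eq_sym.
by apply/eqP => /nrm_eq0.
Qed.

Lemma nrmD x y : nrm (x + y) <= nrm x + nrm y.
Proof. by rewrite -lecR rmorphD /= -!nrmE ler_normD. Qed.

Lemma nrmN x : nrm (- x) = nrm x.
Proof. by rewrite /nrm normrN. Qed.

Lemma nrmC x y : nrm (x - y) = nrm (y - x).
Proof. by rewrite -nrmN opprB. Qed.

Lemma nrmB x y : nrm (x - y) <= nrm x + nrm y.
Proof. by rewrite -(nrmN y) nrmD. Qed.

Lemma nrm_tri z x y : nrm (x - y) <= nrm (x - z) + nrm (z - y).
Proof. by have := nrmD (x - z) (z - y); rewrite addrA subrK. Qed.

Lemma nrm_sub_le x y : nrm x <= nrm y + nrm (x - y).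
Proof. by have := nrmD y (x - y); rewrite addrC subrK. Qed.

Lemma nrm_sub_small x : (forall e : R, 0 < e -> nrm x < e) -> x = 0.
Proof.
move=> h; apply: nrm_eq0; apply/eqP; rewrite eq_le nrm_ge0 andbT.
by apply/ler_addgt0Pl => e e0; rewrite addr0 ltW // h.
Qed.



Lemma nrmZ (a : R[i]) x : nrm (a *: x) = md a * nrm x.
Proof. by apply/complexI; rewrite rmorphM /= -!nrmE -mdE normrZ. Qed.

Lemma nbhs_nrmP (x : X) (P : set X) :
  nbhs x P <-> exists2 e : R, 0 < e & forall y, nrm (y - x) < e -> P y.
Proof.
split.
  move=> /nbhs_normP [e /gtc0_real [-> e0] h]; exists (complex.Re e) => // y hy.
  by apply: h; rewrite /ball_ /= nrmE ltcR nrmC.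
move=> [e e0 h]; apply/nbhs_normP; exists e%:C; first by rewrite /= gtc0E.
by move=> y; rewrite /ball_ /= nrmE ltcR nrmC; apply: h.
Qed.

Lemma closed_nrmP (A : set X) :
  closed A <-> forall x, (forall e : R, 0 < e -> exists2 a, A a & nrm (x - a) < e) -> A x.
Proof.
split=> [cA x h|h x cx].
  apply: cA => B /nbhs_nrmP [e e0 hB]; have [a Aa ha] := h _ e0.
  by exists a; split => //; apply: hB; rewrite nrmC.
apply: h => e e0; have [|a [Aa ha]] := cx [set y | nrm (x - y) < e].
  by apply/nbhs_nrmP; exists e => // y; rewrite nrmC.
by exists a.
Qed.


Lemma cauchy_seq_cvg (K : numFieldType) (V : completeNormedModType K) (u : nat -> V) :
  (forall e : K, 0 < e -> exists N, forall m n, (N <= m)%N -> (N <= n)%N ->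
     `|u m - u n| < e) ->
  exists l, forall e : K, 0 < e -> exists N, forall n, (N <= n)%N -> `|l - u n| < e.
Proof.
move=> h.
have /cauchy_cvgP cu : cauchy (u @ \oo).
  apply: cauchy_exP => e e0; have [N hN] := h _ e0; exists (u N).
  exists N => // n /= Nn; rewrite -ball_normE /ball_ /=; exact: hN.
exists (lim (u @ \oo)) => e e0.
move/cvgrPdist_lt : cu => /(_ _ e0) [N _ hN].
by exists N => n Nn; apply: hN.
Qed.

Definition tends (u : nat -> X) (l : X) :=
  forall e : R, 0 < e -> exists N, forall n, (N <= n)%N -> nrm (l - u n) < e.

Lemma complete_seq (u : nat -> X) :
  (forall e : R, 0 < e -> exists N, forall m n, (N <= m)%N -> (N <= n)%N ->
     nrm (u m - u n) < e) -> exists l, tends u l.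
Proof.
move=> h; have [|l hl] := @cauchy_seq_cvg _ X u.
  move=> e /gtc0_real [-> /h [N hN]]; exists N => m n Nm Nn.
  by rewrite nrmE ltcR; apply: hN.
exists l => e e0; have [|N hN] := hl e%:C; first by rewrite gtc0E.
by exists N => n Nn; rewrite -ltcR -nrmE; apply: hN.
Qed.

Lemma complete_scalar (u : nat -> R[i]) :
  (forall e : R, 0 < e -> exists N, forall m n, (N <= m)%N -> (N <= n)%N ->
     md (u m - u n) < e) -> exists l, forall e : R, 0 < e ->
    exists N, forall n, (N <= n)%N -> md (l - u n) < e.
Proof.
move=> h.
have [|a ha] := @cauchy_seq_cvg R R (fun n => complex.Re (u n)).
  move=> e /h [N hN]; exists N => m n Nm Nn; apply: le_lt_trans (hN _ _ Nm Nn).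
  by rewrite -raddfB; apply: Re_md.
have [|b hb] := @cauchy_seq_cvg R R (fun n => complex.Im (u n)).
  move=> e /h [N hN]; exists N => m n Nm Nn; apply: le_lt_trans (hN _ _ Nm Nn).
  by rewrite -raddfB; apply: Im_md.
exists (a +i* b) => e e0.
have e2 : 0 < e / 2 by rewrite divr_gt0.
have [N hN] := ha _ e2; have [N' hN'] := hb _ e2.
exists (maxn N N') => n; rewrite geq_max => /andP [/hN h1 /hN' h2].
apply: le_lt_trans (md_ReIm _) _; rewrite !raddfB /=; lra.
Qed.

Lemma continuous_bounded (F : {linear X -> X}) : continuous F ->
  exists2 L : R, 0 < L & forall x, nrm (F x) <= L * nrm x.
Proof.
move=> cF.
have /cF /nbhs_nrmP [e e0 he] : nbhs (F 0) [set y | nrm y < 1].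
  by apply/nbhs_nrmP; exists 1 => //= y; rewrite linear0 subr0.
exists (2 / e); first by rewrite divr_gt0.
move=> x; have [->|/eqP x0] := eqVneq x 0; first by rewrite linear0 !nrm0 mulr0.
have nx := nrm_gt0 x0.
(* [t *: x] has norm [e / 2], inside the ball on which [F] is bounded by 1. *)
pose t := e / (2 * nrm x); have t0 : 0 < t by rewrite divr_gt0 // mulr_gt0.
have /he /= : nrm (t%:C *: x - 0) < e.
  rewrite subr0 nrmZ md_real gtr0_norm // /t.
  suff -> : e / (2 * nrm x) * nrm x = e / 2 by lra.
  by field; rewrite gt_eqF.
rewrite linearZ nrmZ md_real gtr0_norm // => /ltW h.
rewrite -(ler_pM2l t0); apply: le_trans h _.
by rewrite /t le_eqVlt; apply/orP; left; apply/eqP; field; rewrite !gt_eqF.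
Qed.

End RealNorm.

(** * Relative codimension *)

Section Subspaces.
Variable R : realType.
Variable X : completeNormedModType R[i].
Implicit Types (A B M V W : set X) (x y w : X) (F : X -> X).

Lemma subsp0 M : is_subspace M -> M 0.
Proof. by case. Qed.

Lemma subspD M x y : is_subspace M -> M x -> M y -> M (x + y).
Proof. by case=> _ [h _]; apply: h. Qed.

Lemma subspZ M a x : is_subspace M -> M x -> M (a *: x).
Proof. by case=> _ [_ h]; apply: h. Qed.

Lemma subspN M x : is_subspace M -> M x -> M (- x).
Proof. by move=> hM Mx; rewrite -scaleN1r; apply: subspZ. Qed.

Lemma subspB M x y : is_subspace M -> M x -> M y -> M (x - y).
Proof. by move=> hM Mx My; apply: subspD => //; apply: subspN. Qed.

Lemma subsp_sum (I : Type) (s : seq I) (P : pred I) M (f : I -> X) :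
  is_subspace M -> (forall i, P i -> M (f i)) -> M (\sum_(i <- s | P i) f i).
Proof.
move=> hM h; elim/big_rec: _ => [|i x Pi Mx]; first exact: subsp0.
by apply: subspD => //; apply: h.
Qed.

Lemma subspZE M a x : is_subspace M -> a != 0 -> M (a *: x) -> M x.
Proof. by move=> hM a0 /(subspZ a^-1 hM); rewrite scalerA mulVf // scale1r. Qed.

Lemma subsp_set0 : is_subspace [set (0 : X)].
Proof.
split=> //; split=> [x y /= -> ->|a x /= ->]; by rewrite ?addr0 ?scaler0.
Qed.

Lemma subsp_setT : is_subspace [set: X].
Proof. by []. Qed.

Lemma subspI A B : is_subspace A -> is_subspace B -> is_subspace (A `&` B).
Proof.
move=> hA hB; split; first by split; apply: subsp0.
split=> [x y [? ?] [? ?]|a x [? ?]]; split; by [apply: subspD|apply: subspZ].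
Qed.

Definition addsp A B : set X := [set x | exists a b, [/\ A a, B b & x = a + b]].

Lemma subsp_add A B : is_subspace A -> is_subspace B -> is_subspace (addsp A B).
Proof.
move=> hA hB; split; first by exists 0, 0; split; rewrite ?addr0 //; apply: subsp0.
split=> [x y [a [b [Aa Bb ->]]] [a' [b' [Aa' Bb' ->]]]|c x [a [b [Aa Bb ->]]]].
  by exists (a + a'), (b + b'); split; [exact: subspD|exact: subspD|rewrite addrACA].
by exists (c *: a), (c *: b); split; [exact: subspZ|exact: subspZ|rewrite scalerDr].
Qed.

Lemma addspl A B : is_subspace B -> A `<=` addsp A B.
Proof. by move=> hB x Ax; exists x, 0; split; rewrite ?addr0 //; apply: subsp0. Qed.

Lemma addspr A B : is_subspace A -> B `<=` addsp A B.
Proof. by move=> hA x Bx; exists 0, x; split; rewrite ?add0r //; apply: subsp0. Qed.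

Lemma addsp_sub A B V : is_subspace V -> A `<=` V -> B `<=` V -> addsp A B `<=` V.
Proof. by move=> hV AV BV _ [a [b [/AV Va /BV Vb ->]]]; apply: subspD. Qed.

Definition line w : set X := [set x | exists c, x = c *: w].

Lemma subsp_line w : is_subspace (line w).
Proof.
split; first by exists 0; rewrite scale0r.
split=> [x y [c ->] [d ->]|a x [c ->]]; first by exists (c + d); rewrite scalerDl.
by exists (a * c); rewrite scalerA.
Qed.

Definition addline B w := addsp B (line w).

Lemma subsp_addline B w : is_subspace B -> is_subspace (addline B w).
Proof. by move=> hB; apply: subsp_add => //; apply: subsp_line. Qed.

Lemma addline_sub B w : B `<=` addline B w.
Proof. exact/addspl/subsp_line. Qed.

Lemma addlineP B w x : addline B w x <-> exists c, B (x - c *: w).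
Proof.
split=> [[b [_ [Bb [c ->] ->]]]|[c h]]; first by exists c; rewrite addrK.
by exists (x - c *: w), (c *: w); split; rewrite ?subrK //; exists c.
Qed.

Lemma codim_leP V B k : codim_le V B k <-> exists t : 'I_k -> X,
  forall x, V x -> exists c : 'I_k -> R[i], B (x - \sum_i c i *: t i).
Proof.
split=> [[s [sk h]]|[t h]].
  subst k; exists (fun i => s`_i) => x /h [a [v [Ba [[c ->] ->]]]].
  by exists c; rewrite addrK.
have sz : size [seq t i | i <- enum 'I_k] = k by rewrite size_map size_enum_ord.
exists [seq t i | i <- enum 'I_k]; split => // x /h [c hc].
exists (x - \sum_i c i *: t i), (\sum_i c i *: t i); split=> //; split; last by rewrite subrK.
exists (fun i => c (cast_ord sz i)).
rewrite (reindex (cast_ord (esym sz))) /=; last first.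
  by exists (cast_ord sz) => i _; rewrite ?cast_ordK ?cast_ordKV.
apply: eq_bigr => i _; rewrite cast_ordKV; congr (_ *: _).
by rewrite (nth_map i) ?size_enum_ord //= nth_ord_enum.
Qed.

Lemma codim_le0 V B : codim_le V B 0 <-> V `<=` B.
Proof.
rewrite codim_leP; split=> [[t h] x /h [c]|h].
  by rewrite big_ord0 subr0.
exists (fun _ => 0) => x Vx; exists (fun _ => 0).
by rewrite big_ord0 subr0; apply: h.
Qed.

Lemma dim_le_codim V k : dim_le V k <-> codim_le V [set 0] k.
Proof.
split=> [[s [sk h]]|[s [sk h]]]; exists s; split=> //.
  by move=> x /h sx; exists 0, x; rewrite add0r.
by move=> x /h [a [v [-> [sv ->]]]]; rewrite add0r.
Qed.

Lemma codim_le_sub V V' B B' k :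
  V' `<=` V -> B `<=` B' -> codim_le V B k -> codim_le V' B' k.
Proof.
move=> VV BB [s [sk h]]; exists s; split=> // x /VV /h [a [v [/BB ? [? ?]]]].
by exists a, v.
Qed.

Lemma codim_le_trans V B A n m :
  codim_le V B n -> codim_le B A m -> codim_le V A (n + m).
Proof.
rewrite !codim_leP => -[t ht] [u hu].
exists (fun i => match fintype.split i with inl j => t j | inr j => u j end).
move=> x /ht [c /hu [d hd]].
exists (fun i => match fintype.split i with inl j => c j | inr j => d j end).
rewrite big_split_ord /= opprD addrA.
have -> : \sum_(i < n) match fintype.split (lshift m i) with inl j => c j | inr j => d j end *:
   match fintype.split (lshift m i) with inl j => t j | inr j => u j end = \sum_i c i *: t i.
  by apply: eq_bigr => i _; rewrite -/(unsplit (inl _ i)) unsplitK.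
have -> : \sum_(i < m) match fintype.split (rshift n i) with inl j => c j | inr j => d j end *:
   match fintype.split (rshift n i) with inl j => t j | inr j => u j end = \sum_i d i *: u i.
  by apply: eq_bigr => i _; rewrite -/(unsplit (inr _ i)) unsplitK.
exact: hd.
Qed.

Lemma codim_le_addline B w : codim_le (addline B w) B 1.
Proof.
apply/codim_leP; exists (fun _ => w) => x /addlineP [c h].
by exists (fun _ => c); rewrite big_ord1.
Qed.

Lemma codim_le_leq V B k k' : (k <= k')%N -> codim_le V B k -> codim_le V B k'.
Proof.
move=> kk h; rewrite -(subnKC kk); elim: (k' - k)%N => [|n IH]; first by rewrite addn0.
have hB : codim_le B B 1.
  apply/codim_leP; exists (fun _ => 0) => x Bx; exists (fun _ => 0).
  by rewrite big_ord1 scaler0 subr0.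
by rewrite addnS -addn1; apply: codim_le_trans IH hB.
Qed.

Lemma codim_leS V B w k : codim_le V (addline B w) k -> codim_le V B k.+1.
Proof. by move=> h; rewrite -addn1; apply: codim_le_trans h (codim_le_addline _ _). Qed.

(** Steinitz exchange: modulo [B], [w] has a nonzero coefficient on some [t j], so [t j] can be
    expressed through [w] and the other vectors. *)
Lemma codim_le_exchange V B w k : is_subspace B -> V w -> ~ B w ->
  codim_le V B k.+1 -> codim_le V (addline B w) k.
Proof.
move=> hB Vw Bw; rewrite !codim_leP => -[t ht].
have [c hc] := ht _ Vw.
have [j cj] : exists j, c j != 0.
  apply: contrapT => /forallNP h; apply: Bw.
  move: hc; rewrite big1 ?subr0 // => i _.
  by move/negP: (h i); rewrite negbK => /eqP ->; rewrite scale0r.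
exists (fun i => t (lift j i)) => x /ht [d hd].
(* Subtracting [d j / c j] times the expansion of [w] removes the term in [t j]. *)
exists (fun i => d (lift j i) - d j / c j * c (lift j i)).
apply/addlineP; exists (d j / c j).
move: hd (subspZ (d j / c j) hB hc).
rewrite !(bigD1_ord j) //= => hd /(subspB hB hd).
rewrite (_ : _ - _ = x - \sum_(i < k) (d (lift j i) - d j / c j * c (lift j i)) *: t (lift j i) - (d j / c j) *: w) //.
under [X in _ = _ - X - _]eq_bigr do rewrite scalerBl -scalerA.
rewrite sumrB -scaler_sumr scalerBr scalerDr !scalerA divfK //.
set a := d j *: t j; set b := \sum_(i < k) _; set e := _ *: w; set f := _ *: _.
rewrite [- (e - _)]opprB [- (b - f)]opprB !addrA; congr (_ - _).
by rewrite opprD !addrA -(addrA x) (addrC (- a)) addrA addrNK addrAC.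
Qed.

End Subspaces.

(** * Linear maps, exact codimension and index *)

Section LinearMaps.
Variable R : realType.
Variable X : completeNormedModType R[i].
Implicit Types (A B M V W : set X) (x y w : X) (F : X -> X).

Definition lin F : Prop :=
  (forall x y, F (x + y) = F x + F y) /\ (forall (a : R[i]) x, F (a *: x) = a *: F x).

Lemma linD F x y : lin F -> F (x + y) = F x + F y. Proof. by case. Qed.
Lemma linZ F a x : lin F -> F (a *: x) = a *: F x. Proof. by case. Qed.

Lemma lin0 F : lin F -> F 0 = 0.
Proof. by move=> hF; rewrite -[X in F X](scale0r (0 : X)) (linZ _ _ hF) scale0r. Qed.

Lemma linN F x : lin F -> F (- x) = - F x.
Proof. by move=> hF; rewrite -scaleN1r (linZ _ _ hF) scaleN1r. Qed.

Lemma linB F x y : lin F -> F (x - y) = F x - F y.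
Proof. by move=> hF; rewrite (linD _ _ hF) linN. Qed.

Lemma lin_sum F (I : Type) (s : seq I) (P : pred I) (f : I -> X) :
  lin F -> F (\sum_(i <- s | P i) f i) = \sum_(i <- s | P i) F (f i).
Proof.
by move=> hF; apply: (big_morph F (fun x y => linD x y hF) (lin0 hF)).
Qed.

Lemma lin_iter F n : lin F -> lin (iter n F).
Proof.
move=> hF; elim: n => [|n IH] //=; split=> [x y|a x].
  by rewrite /= (linD _ _ IH) linD.
by rewrite /= (linZ _ _ IH) linZ.
Qed.

Lemma lin_shift F l : lin F -> lin (shift F l).
Proof.
move=> hF; split=> [x y|a x]; rewrite /shift /=.
  by rewrite (linD _ _ hF) scalerDr opprD addrACA.
by rewrite (linZ _ _ hF) scalerBr !scalerA mulrC.
Qed.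

Lemma shift0 F : shift F 0 = F.
Proof. by apply/funext => x; rewrite /shift scale0r subr0. Qed.

Lemma shiftD F a b : shift (shift F a) b = shift F (a + b).
Proof. by apply/funext => x; rewrite /shift scalerDl opprD addrA. Qed.

Lemma subsp_img F V : lin F -> is_subspace V -> is_subspace (F @` V).
Proof.
move=> hF hV; split; first by exists 0; rewrite ?(lin0 hF) //; apply: subsp0.
split=> [_ _ [x Vx <-] [y Vy <-]|a _ [x Vx <-]].
  by exists (x + y); rewrite ?(linD _ _ hF) //; apply: subspD.
by exists (a *: x); rewrite ?(linZ _ _ hF) //; apply: subspZ.
Qed.

Lemma subsp_pre F B : lin F -> is_subspace B -> is_subspace (F @^-1` B).
Proof.
move=> hF hB; split; first by rewrite /preimage /= (lin0 hF); apply: subsp0.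
split=> [x y Bx By|a x Bx]; rewrite /preimage /=.
  by rewrite (linD _ _ hF); apply: subspD.
by rewrite (linZ _ _ hF); apply: subspZ.
Qed.

Lemma subsp_ker F V : lin F -> is_subspace V -> is_subspace (kerM V F).
Proof. by move=> hF hV; apply: subspI => //; apply: (@subsp_pre F [set 0] hF); apply: subsp_set0. Qed.

Lemma invariant_iter V F n : invariant V F -> invariant V (iter n F).
Proof. by move=> h; elim: n => [//|n IH] x Vx; apply/h/IH. Qed.

Lemma invariant_shift V F l : is_subspace V -> invariant V F -> invariant V (shift F l).
Proof. by move=> hV h x Vx; apply: subspB => //; [apply: h|apply: subspZ]. Qed.

Lemma rng_iterS V F n : rngM V (iter n.+1 F) = F @` rngM V (iter n F).
Proof.
by apply/seteqP; split=> [_ [x Vx <-]|_ [_ [x Vx <-] <-]];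
  [exists (iter n F x) => //; exists x|exists x].
Qed.

Lemma rng_iter_sub V F n m : invariant V F -> (n <= m)%N ->
  rngM V (iter m F) `<=` rngM V (iter n F).
Proof.
move=> h nm _ [x Vx <-]; rewrite -(subnKC nm) iterD.
by exists (iter (m - n) F x) => //; apply: invariant_iter.
Qed.

Lemma ker_iter_sub V F n m : lin F -> (n <= m)%N ->
  kerM V (iter n F) `<=` kerM V (iter m F).
Proof.
move=> hF nm x [Vx /= h]; split=> //=; rewrite -(subnK nm) iterD h.
by apply: lin0; apply: lin_iter.
Qed.

(** [F] identifies [V] modulo the preimage of [B] with its image modulo [B]. From left to right the
    spanning vectors cannot be lifted, as [codim_le] does not ask them to lie in the image; vectors
    of [V] outside the preimage are adjoined one at a time instead. *)
Lemma codim_le_img F V B k : lin F -> is_subspace V -> is_subspace B ->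
  codim_le (F @` V) B k <-> codim_le V (F @^-1` B) k.
Proof.
move=> hF hV hB; split; last first.
  move/codim_leP => [t ht]; apply/codim_leP; exists (fun i => F (t i)).
  move=> _ [x /ht [c hc] <-]; exists c.
  have <- : F (\sum_i c i *: t i) = \sum_i c i *: F (t i).
    by rewrite (lin_sum _ _ _ hF); apply: eq_bigr => i _; apply: (linZ _ _ hF).
  by rewrite -(linB _ _ hF).
elim: k B hB => [|k IH] B hB.
  by rewrite !codim_le0 => h x Vx; apply: h; exists x.
move=> h; have [VB|] := pselect (V `<=` F @^-1` B).
  by apply: (@codim_le_leq _ _ _ _ 0) => //; apply/codim_le0.
move/existsNP => [w /not_implyP [Vw Bw]].
apply: (@codim_leS _ _ _ _ w).
have /IH : codim_le (F @` V) (addline B (F w)) k.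
  by apply: codim_le_exchange => //; exists w.
move/(_ (subsp_addline _ hB)); apply: codim_le_sub => // x /addlineP [c].
by rewrite -(linZ _ _ hF) -(linB _ _ hF) => h'; apply/addlineP; exists c.
Qed.

(** Spanning vectors may lie outside [V], and then so may the component in [B] of a vector of [V];
    the induction exchanges them for vectors of [V]. *)
Lemma codim_le_cap V B k : is_subspace V -> is_subspace B ->
  codim_le V B k <-> codim_le V (V `&` B) k.
Proof.
move=> hV hB; split; last by apply: codim_le_sub => // x [].
elim: k B hB => [|k IH] B hB h.
  by move: h; rewrite !codim_le0 => h x Vx; split=> //; apply: h.
have [VB|] := pselect (V `<=` B).
  by apply: (@codim_le_leq _ _ _ _ 0) => //; apply/codim_le0 => x Vx; split=> //; apply: VB.
move/existsNP => [w /not_implyP [Vw Bw]].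
apply: (@codim_leS _ _ _ _ w).
have /IH : codim_le V (addline B w) k by apply: codim_le_exchange.
move/(_ (subsp_addline _ hB)); apply: codim_le_sub => // x [Vx /addlineP [c h']].
by apply/addlineP; exists c; split=> //; apply: subspB => //; apply: subspZ.
Qed.

Lemma codim_le_addsp V W B k : is_subspace W -> is_subspace B -> W `<=` B ->
  codim_le (addsp V W) B k <-> codim_le V B k.
Proof.
move=> hW hB WB; split; first by apply: codim_le_sub => //; apply: addspl.
move=> [s [sk h]]; exists s; split=> // _ [a [b [/h [a' [v [Ba' [sv ->]]]] /WB Bb ->]]].
by exists (a' + b), v; split; [exact: subspD|split => //; rewrite addrAC].
Qed.

(** Stated for all [k] so that it passes along equivalences of [codim_le]; unlike an equation on
    [codimn], which has a default value, it entails finiteness. *)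
Definition codim_is V B n := forall k, codim_le V B k <-> (n <= k)%N.

Lemma codim_is_uniq V B n m : codim_is V B n -> codim_is V B m -> n = m.
Proof.
move=> h h'; apply/eqP; rewrite eqn_leq.
by apply/andP; split; [apply/h/h'|apply/h'/h].
Qed.

Lemma codim_is_exists V B k : codim_le V B k -> exists n, codim_is V B n.
Proof.
move=> h; have e : exists n, `[< codim_le V B n >] by exists k; apply/asboolP.
case: (ex_minnP e) => n /asboolP hn hmin; exists n => j; split.
  by move=> hj; apply: hmin; apply/asboolP.
by move=> nj; apply: codim_le_leq nj hn.
Qed.

Lemma codim_is_le V B n : codim_is V B n -> codim_le V B n.
Proof. by move=> h; apply/h. Qed.

Lemma codimnE V B n : codim_is V B n -> codimn V B = n.
Proof.
move=> h; apply: xget_unique; first by split=> [|k /h //]; apply/h.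
by move=> m [hm hmin]; apply/eqP; rewrite eqn_leq hmin ?(codim_is_le h) //=; apply/h.
Qed.

Lemma dimn_codimn V : dimn V = codimn V [set 0].
Proof.
rewrite /dimn /codimn; congr xget; apply/seteqP.
by split=> n [/dim_le_codim h hmin]; split=> // k /dim_le_codim /hmin.
Qed.

Lemma findimE V : findim V <-> fincodim V [set 0].
Proof. by split=> -[n /dim_le_codim h]; exists n. Qed.

Lemma codim_is_eq V B V' B' n : (forall k, codim_le V B k <-> codim_le V' B' k) ->
  codim_is V B n -> codim_is V' B' n.
Proof. by move=> h hn k; rewrite -h. Qed.

(** Adjoining to [A] a vector of [B] outside [A] lowers both codimensions by one, which reduces the
    lower bound to [A = B]. *)
Lemma codim_is_add V B A n m : is_subspace B -> is_subspace A -> B `<=` V -> A `<=` B ->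
  codim_is V B n -> codim_is B A m -> codim_is V A (n + m).
Proof.
move=> hB hA BV AB hn hm k; split; last first.
  by move=> /codim_le_leq; apply; apply: codim_le_trans; [apply/hn|apply/hm].
elim: m A hA AB hm k => [|m IH] A hA AB hm k h.
  by rewrite addn0; apply/hn; apply: codim_le_sub h.
have /existsNP [w /not_implyP [Bw Aw]] : ~ (B `<=` A) by move/codim_le0/hm.
case: k => [|k] in h *; first by case: Aw; move/codim_le0 : h; apply; apply: BV.
rewrite addnS ltnS; apply: (IH (addline A w)).
- exact: subsp_addline.
- move=> x /addlineP [c /AB h']; rewrite -(subrK (c *: w) x).
  by apply: subspD => //; apply: subspZ.
- move=> j; split=> [/codim_leS /hm|mj]; first by rewrite ltnS.
  by apply: codim_le_exchange => //; apply/hm.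
- by apply: codim_le_exchange => //; apply: BV.
Qed.

(** As [V1] meets [V2] only in 0, each summand cuts [B1 + B2] exactly in its own part. *)
Lemma codim_le_dsum V1 V2 B1 B2 V B k :
  is_subspace V1 -> is_subspace V2 -> is_subspace B1 -> is_subspace B2 ->
  B1 `<=` V1 -> B2 `<=` V2 -> V1 `&` V2 `<=` [set 0] ->
  V = addsp V1 V2 -> B = addsp B1 B2 ->
  codim_le V B k -> codim_le V1 B1 k /\ codim_le V2 B2 k.
Proof.
move=> h1 h2 hB1 hB2 B1V B2V VV -> -> h; split.
  have : codim_le V1 (addsp B1 B2) k by apply: codim_le_sub h => //; apply: addspl.
  move/(codim_le_cap _ h1 (subsp_add hB1 hB2)); apply: codim_le_sub => //.
  move=> y [Vx [a [b [Ba Bb xab]]]]; rewrite xab; suff -> : b = 0 by rewrite addr0.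
  apply: VV; split; last exact: B2V.
  by rewrite (_ : b = (a + b) - a); [rewrite -xab; apply: subspB => //; apply: B1V|rewrite addrC addKr].
have : codim_le V2 (addsp B1 B2) k by apply: codim_le_sub h => //; apply: addspr.
move/(codim_le_cap _ h2 (subsp_add hB1 hB2)); apply: codim_le_sub => //.
move=> y [Vx [a [b [Ba Bb xab]]]]; rewrite xab; suff -> : a = 0 by rewrite add0r.
apply: VV; split; first exact: B1V.
by rewrite (_ : a = (a + b) - b); [rewrite -xab; apply: subspB => //; apply: B2V|rewrite addrK].
Qed.

(** The chain [V1 + V2], [V1 + B2], [B1 + B2] has steps of codimension [m] and [n]. *)
Lemma codim_is_dsum V1 V2 B1 B2 V B n m :
  is_subspace V1 -> is_subspace V2 -> is_subspace B1 -> is_subspace B2 ->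
  B1 `<=` V1 -> B2 `<=` V2 -> V1 `&` V2 `<=` [set 0] ->
  V = addsp V1 V2 -> B = addsp B1 B2 ->
  codim_is V1 B1 n -> codim_is V2 B2 m -> codim_is V B (n + m).
Proof.
move=> h1 h2 hB1 hB2 B1V B2V VV -> -> hn hm; rewrite addnC.
have hW : is_subspace (addsp V1 B2) by apply: subsp_add.
have hB : is_subspace (addsp B1 B2) by apply: subsp_add.
apply: (@codim_is_add _ (addsp V1 B2)) => //.
- by move=> _ [a [b [Va /B2V Vb ->]]]; exists a, b.
- by move=> _ [a [b [/B1V Va Vb ->]]]; exists a, b.
- apply: codim_is_eq hm => k; split=> [[s [sk h]]|].
    exists s; split=> // _ [a [_ [Va /h [b [v [Bb [sv ->]]]] ->]]].
    by exists (a + b), v; split; [exists a, b|rewrite addrA].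
  move=> h; have VE : addsp V1 V2 = addsp V1 V2 by [].
  by have [] := codim_le_dsum h1 h2 h1 hB2 (@subset_refl _ _) B2V VV VE erefl h.
- apply: codim_is_eq hn => k; split=> [[s [sk h]]|].
    exists s; split=> // _ [_ [c [/h [b [v [Bb [sv ->]]]] Bc ->]]].
    by exists (b + c), v; split; [exists b, c|rewrite addrAC].
  have VB : V1 `&` B2 `<=` [set 0] by move=> x [? /B2V ?]; apply: VV.
  by move=> h; have [] := codim_le_dsum h1 hB2 hB1 hB2 B1V (@subset_refl _ _) VB erefl erefl h.
Qed.

(* Count [codim Y] through [R(F)] and through [Y + N(F)]: both quotients [R(F)/Y] and
   [V/(Y + N(F))] are isomorphic via [F]. *)
Lemma index_zero_of_core F V Y d : lin F -> is_subspace V -> is_subspace Y ->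
  invariant V F -> Y `<=` V -> F @` Y = Y -> kerM V F `&` Y `<=` [set 0] -> codim_le V Y d ->
  exists n, codim_is (kerM V F) [set 0] n /\ codim_is V (rngM V F) n.
Proof.
move=> hF hV hY iV YV FY kY hd.
have hR : is_subspace (rngM V F) by apply: subsp_img.
have hK : is_subspace (kerM V F) by apply: subsp_ker.
have YR : Y `<=` rngM V F by rewrite -FY => _ [x /YV Vx <-]; exists x.
have RV : rngM V F `<=` V by move=> _ [x /iV Fx <-].
have [m hm] : exists m, codim_is V (rngM V F) m.
  by apply: (@codim_is_exists _ _ d); apply: codim_le_sub hd.
have [e he] : exists e, codim_is (rngM V F) Y e.
  by apply: (@codim_is_exists _ _ d); apply: codim_le_sub hd.
have [n hn] : exists n, codim_is (kerM V F) [set 0] n.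
  apply: (@codim_is_exists _ _ d).
  have /(codim_le_cap _ hK hY) : codim_le (kerM V F) Y d by apply: codim_le_sub hd => // x [].
  by apply: codim_le_sub.
exists n; split=> //; suff -> : n = m by [].
pose W := addsp (kerM V F) Y.
have hW : is_subspace W by apply: subsp_add.
have WE : W = V `&` F @^-1` Y.
  apply/seteqP; split=> [_ [a [b [[Va /= Fa] Yb ->]]]|x [Vx /=]].
    split; first by apply: subspD => //; apply: YV.
    by rewrite /= (linD _ _ hF) Fa add0r -FY; exists b.
  rewrite -{1}FY => -[y Yy Fxy]; exists (x - y), y; rewrite subrK; split=> //.
  split; first by apply: subspB => //; apply: YV.
  by rewrite /= (linB _ _ hF) Fxy subrr.
have h1 : codim_is V W e.
  apply: codim_is_eq he => k; rewrite WE -codim_le_cap //; last exact: subsp_pre.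
  exact: codim_le_img.
have h2 : codim_is W Y n.
  apply: codim_is_eq hn => k; rewrite codim_le_addsp // [X in _ <-> X]codim_le_cap //.
  suff -> : kerM V F `&` Y = [set 0] by [].
  by apply/seteqP; split=> // x ->; split; apply: subsp0.
have WV : W `<=` V by rewrite WE => x [].
have h3 := codim_is_add hW hY WV (addspr hK) h1 h2.
have h4 := codim_is_add hR hY RV YR hm he.
by have := codim_is_uniq h3 h4; rewrite addnC => /addIn.
Qed.

End LinearMaps.

(** * Gap between subspaces *)

Section Gap.
Variable R : realType.
Variable X : completeNormedModType R[i].
Implicit Types (A B M V W : set X) (x y w : X) (F : X -> X).

Lemma closed_dist A x : closed A -> ~ A x ->
  exists2 d : R, 0 < d & forall a, A a -> d <= nrm (x - a).
Proof.
move=> /closed_nrmP cA Ax; apply: contrapT => h; apply: Ax; apply: cA => e e0.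
apply: contrapT => h'; apply: h; exists e => // a Aa.
by rewrite leNgt; apply/negP => h; apply: h'; exists a.
Qed.

(** If [w] has distance at least [d > 0] from [B], then [|c| * d] is at most the norm of
    [b + c *: w]. The coefficients of a convergent sequence are thus Cauchy, and the parts in [B]
    converge with them. *)
Lemma closed_addline B w : is_subspace B -> closed B -> closed (addline B w).
Proof.
move=> hB cB; have [Bw|Bw] := pselect (B w).
  suff -> : addline B w = B by [].
  apply/seteqP; split; last exact: addline_sub.
  move=> x /addlineP [c h]; rewrite -(subrK (c *: w) x).
  by apply: subspD => //; apply: subspZ.
have [d d0 hd] := closed_dist cB Bw.
have hc b c : B b -> md c * d <= nrm (b + c *: w).
  move=> Bb; have [->|c0] := eqVneq c 0; first by rewrite md0 mul0r nrm_ge0.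
  have -> : b + c *: w = c *: (w - (- c^-1) *: b).
    by rewrite scaleNr opprK scalerDr scalerA divff // scale1r addrC.
  by rewrite nrmZ ler_wpM2l ?md_ge0 //; apply: hd; apply: subspZ.
apply/closed_nrmP => x hx.
have /choice [u hu] : forall n : nat, exists bc : X * R[i],
    B bc.1 /\ nrm (x - (bc.1 + bc.2 *: w)) < n.+1%:R^-1.
  move=> n; have [|_ [b [_ [Bb [c ->] ->]]] h] := hx n.+1%:R^-1.
    by rewrite invr_gt0 ltr0n.
  by exists (b, c).
have hN (e : R) : 0 < e -> exists N, forall n, (N <= n)%N -> (n.+1%:R^-1 : R) < e.
  move=> e0; have := archi_boundP (ltW (_ : 0 < e^-1)).
  move=> /(_ (_ : _)) h; exists (Num.bound e^-1) => n Nn.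
  rewrite -[e]invrK ltf_pV2 ?posrE ?invr_gt0 ?ltr0n //.
  apply: lt_le_trans (h _) _; first by rewrite invr_gt0.
  by rewrite ler_nat ltnW.
have [|c hcl] := @complete_scalar R (fun n => (u n).2).
  move=> e e0; have ed : 0 < e * d / 2 by rewrite divr_gt0 // mulr_gt0.
  have [N h] := hN _ ed; exists N => m n Nm Nn.
  rewrite -(ltr_pM2r d0).
  have [Bm um] := hu m; have [Bn un] := hu n.
  have := hc ((u m).1 - (u n).1) ((u m).2 - (u n).2) (subspB hB Bm Bn).
  have -> : (u m).1 - (u n).1 + ((u m).2 - (u n).2) *: w =
    ((u m).1 + (u m).2 *: w) - ((u n).1 + (u n).2 *: w).
    by rewrite scalerBl opprD addrACA.
  have := nrm_tri x ((u m).1 + (u m).2 *: w) ((u n).1 + (u n).2 *: w).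
  rewrite [nrm (_ - x)]nrmC.
  by move: (lt_trans um (h _ Nm)) (lt_trans un (h _ Nn)); lra.
apply/addlineP; exists c; move/closed_nrmP: cB; apply => e e0.
have w1 : 0 < nrm w + 1 by apply: ltr_wpDl => //; apply: nrm_ge0.
have e1 : 0 < e / 2 / (nrm w + 1).
  by apply: divr_gt0; [lra|exact: w1].
have [N1 h1] := hcl _ e1; have [N2 h2] := hN _ (divr_gt0 e0 (ltr0Sn _ 1)).
pose n := maxn N1 N2; have [Bn un] := hu n; exists (u n).1 => //.
have -> : x - c *: w - (u n).1 = (x - ((u n).1 + (u n).2 *: w)) - (c - (u n).2) *: w.
  by rewrite opprD scalerBl opprB !addrA subrK addrAC.
apply: le_lt_trans (nrmB _ _) _; rewrite nrmZ.
have a1 := h1 n (leq_maxl _ _); have a2 := lt_trans un (h2 n (leq_maxr _ _)).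
suff : md (c - (u n).2) * nrm w <= e / 2 by lra.
have -> : e / 2 = e / 2 / (nrm w + 1) * (nrm w + 1).
  by rewrite divfK // gt_eqF.
by apply: ler_pM; rewrite ?nrm_ge0 ?md_ge0 ?(ltW a1) //; lra.
Qed.

(** Subtract from [x] a point of [B] whose distance is within a factor 2 of the infimum, and
    normalise. *)
Lemma riesz_lemma V B x : is_subspace V -> is_subspace B -> closed B ->
  B `<=` V -> V x -> ~ B x ->
  exists v, [/\ V v, nrm v = 1 & forall b, B b -> 1 / 2 <= nrm (v - b)].
Proof.
move=> hV hB cB BV Vx Bx; have [d d0 hd] := closed_dist cB Bx.
pose D := [set nrm (x - b) | b in B].
have iD : has_inf D.
  split; first by exists (nrm (x - 0)); exists 0 => //; apply: subsp0.
  by exists d => _ [b /hd h <-].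
have dD : d <= inf D by apply: lb_le_inf; [case: iD|move=> _ [b /hd h <-]].
have [|_ [b Bb <-] hb] := @inf_adherent _ D (inf D) _ iD; first exact: lt_le_trans dD.
have nb : 0 < nrm (x - b) by apply: lt_le_trans (hd _ Bb).
pose t := (nrm (x - b))^-1.
exists (t%:C *: (x - b)); split.
- by apply: subspZ => //; apply: subspB => //; apply: BV.
- by rewrite nrmZ md_real ger0_norm ?invr_ge0 ?nrm_ge0 // mulVf // gt_eqF.
move=> b' Bb'.
have -> : t%:C *: (x - b) - b' = t%:C *: (x - (b + (nrm (x - b))%:C *: b')).
  rewrite opprD addrA [in RHS]scalerBr scalerA -rmorphM /= mulVf ?gt_eqF //.
  by rewrite scale1r.
rewrite nrmZ md_real ger0_norm ?invr_ge0 ?nrm_ge0 //.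
have h : inf D <= nrm (x - (b + (nrm (x - b))%:C *: b')).
  apply: ge_inf; first by case: iD.
  by exists (b + (nrm (x - b))%:C *: b') => //; apply: subspD => //; apply: subspZ.
rewrite -(ler_pM2l nb) [leRHS]mulrA /t divff ?gt_eqF // mul1r; lra.
Qed.

(** The one-sided gap of perturbation theory, with an approximating vector in place of the distance
    to [B]. *)
Definition gap_le A B (d : R) := forall a, A a -> exists2 b, B b & nrm (a - b) <= d * nrm a.

Lemma gap_le_weaken A B d d' : d <= d' -> gap_le A B d -> gap_le A B d'.
Proof.
move=> dd h a /h [b Bb hb]; exists b => //; apply: le_trans hb _.
by rewrite ler_wpM2r // nrm_ge0.
Qed.

(* The width [d] depends on [k] only: this makes the chaining argument of [kato_stable] work. *)
Lemma gap_codim_le k : exists2 d : R, 0 < d & forall V1 V2 B1 B2,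
  is_subspace V1 -> is_subspace V2 -> is_subspace B1 -> is_subspace B2 ->
  closed B1 -> B1 `<=` V1 -> gap_le V1 V2 d -> gap_le B2 B1 d ->
  codim_le V2 B2 k -> codim_le V1 B1 k.
Proof.
elim: k => [|k [dk dk0 IH]].
  exists (1/100); first by lra.
  move=> V1 V2 B1 B2 hV1 hV2 hB1 hB2 cB1 BV1 gV gB /codim_le0 VB2.
  apply/codim_le0 => x Vx; apply: contrapT => Bx.
  (* A unit vector of [V1] at distance 1/2 from [B1] is close to [V2], hence to [B2], hence to [B1]:
     a contradiction. *)
  have [v [Vv v1 hv]] := riesz_lemma hV1 hB1 cB1 BV1 Vx Bx.
  have [w /VB2 Bw hw] := gV _ Vv; have [b Bb hb] := gB _ Bw.
  have := hv _ Bb; have := nrm_tri w v b; have := nrm_sub_le w v.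
  rewrite [nrm (w - v)]nrmC v1; rewrite v1 in hw; lra.
pose d := Num.min (dk / 20) (1/100).
have dle : d <= 1/100 by rewrite ge_min lexx orbT.
have dkle : d <= dk / 20 by rewrite ge_min lexx.
have d0 : 0 < d by rewrite lt_min; apply/andP; split; lra.
exists d => // V1 V2 B1 B2 hV1 hV2 hB1 hB2 cB1 BV1 gV gB hc.
have [VB|] := pselect (V1 `<=` B1).
  by apply: (@codim_le_leq _ _ _ _ 0) => //; apply/codim_le0.
move/existsNP => [x /not_implyP [Vx Bx]].
have [v [Vv v1 hv]] := riesz_lemma hV1 hB1 cB1 BV1 Vx Bx.
have [w Vw hw] := gV _ Vv; rewrite v1 mulr1 in hw.
have nw : nrm w <= 2 by have := nrm_sub_le w v; rewrite nrmC v1; lra.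
have wfar b : B2 b -> 1/4 <= nrm (w - b).
  move=> /[dup] Bb /gB [b' Bb' hb']; have := hv _ Bb'.
  have := nrm_tri w v b'; have := nrm_tri b w b'.
  have := nrm_sub_le b w; rewrite [nrm (b - w)]nrmC => h1 h2 h3 h4.
  have : d * nrm b <= 1/100 * nrm b by rewrite ler_wpM2r ?nrm_ge0.
  lra.
have Bw : ~ B2 w by move/wfar; rewrite subrr nrm0; lra.
apply: (@codim_leS _ _ _ _ v).
(* [w] keeps distance 1/4 from [B2], so [y = b + c *: w] has [|c| <= 4 |y|] and [|b| <= 9 |y|]. The
   enlarged spaces have gap at most [(9 + 4) * d], which explains the divisor 20 in [d]. *)
apply: (IH V1 V2 _ (addline B2 w)) => //.
- exact: subsp_addline.
- exact: subsp_addline.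
- exact: closed_addline.
- move=> y /addlineP [c /BV1 h]; rewrite -(subrK (c *: v) y).
  by apply: subspD => //; apply: subspZ.
- by apply: gap_le_weaken gV; lra.
- move=> y /addlineP [c]; set b := y - _ => Bb; have [b' Bb' hb'] := gB _ Bb.
  have yE : y = b + c *: w by rewrite subrK.
  exists (b' + c *: v); first by apply/addlineP; exists c; rewrite addrK.
  have hcy : md c * (1/4) <= nrm y.
    have [->|c0] := eqVneq c 0; first by rewrite md0 mul0r nrm_ge0.
    have -> : y = c *: (w - (- c^-1) *: b).
      by rewrite scaleNr opprK scalerDr scalerA divff // scale1r addrC.
    by rewrite nrmZ ler_wpM2l ?md_ge0 //; apply: wfar; apply: subspZ.
  have -> : y - (b' + c *: v) = (b - b') + c *: (w - v).
    by rewrite yE opprD addrACA scalerBr.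
  have h1 := nrmD (b - b') (c *: (w - v)); rewrite nrmZ [nrm (w - v)]nrmC in h1.
  have h2 : nrm b <= nrm y + md c * nrm w by rewrite /b -nrmZ; apply: nrmB.
  have h3 : md c * nrm w <= md c * 2 by rewrite ler_wpM2l ?md_ge0.
  have h4 : md c * nrm (v - w) <= md c * d by rewrite ler_wpM2l ?md_ge0.
  have h5 : d * nrm b <= d * (9 * nrm y) by rewrite ler_wpM2l ?(ltW d0) //; lra.
  have h6 : md c * d <= (4 * nrm y) * d by rewrite ler_wpM2r ?(ltW d0) //; lra.
  have h7 : d * nrm y <= dk / 20 * nrm y by rewrite ler_wpM2r ?nrm_ge0.
  have := nrm_ge0 y; move: (mulr_ge0 (ltW dk0) (nrm_ge0 y)) => h8 h9.
  lra.
- exact: codim_le_exchange.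
Qed.

End Gap.

(** * Open mapping theorem *)

Section OpenMapping.
Variable R : realType.
Variable X : completeNormedModType R[i].
Implicit Types (A B M V W Q Z : set X) (x y z w : X) (F G : X -> X).

Definition bop F : Prop :=
  lin F /\ exists2 L : R, 0 < L & forall x, nrm (F x) <= L * nrm x.

Lemma exp2_small (K e : R) : 0 <= K -> 0 < e -> exists n, K / 2 ^+ n < e.
Proof.
move=> K0 e0; exists (Num.bound (K / e)).
rewrite ltr_pdivrMr ?exprn_gt0 // mulrC -ltr_pdivrMr //.
apply: lt_le_trans (archi_boundP _) _; first by rewrite divr_ge0 // ltW.
by rewrite -natrX ler_nat ltnW // ltn_expl.
Qed.

(** Telescoping bounds the tails by [r] itself. Geometric series and the nested balls of Baire's
    theorem both have this form. *)
Lemma nested_limit (y : nat -> X) (r : nat -> R) :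
  (forall n, nrm (y n.+1 - y n) <= r n - r n.+1) -> (forall n, 0 <= r n) ->
  (forall e : R, 0 < e -> exists n, r n < e) ->
  exists l, forall n, nrm (l - y n) <= r n.
Proof.
move=> h r0 hr.
have hd n j : nrm (y (n + j)%N - y n) <= r n - r (n + j)%N.
  elim: j => [|j IH]; first by rewrite addn0 !subrr nrm0.
  rewrite addnS; apply: le_trans (nrm_tri (y (n + j)%N) _ _) _.
  by move: (h (n + j)%N) IH; lra.
have hm n m : (n <= m)%N -> nrm (y m - y n) <= r n.
  by move=> nm; have := hd n (m - n)%N; rewrite subnKC //; have := r0 m; lra.
have [|l hl] := @complete_seq R X y.
  move=> e e0; have [n hn] := hr (e / 2) (divr_gt0 e0 (ltr0Sn _ 1)).
  exists n => m k nm nk; apply: le_lt_trans (nrm_tri (y n) _ _) _.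
  by have := hm _ _ nm; have := hm _ _ nk; rewrite [nrm (y n - _)]nrmC; lra.
exists l => n; apply/ler_addgt0Pr => e e0.
have [N hN] := hl e e0; pose m := maxn n N.
apply: le_trans (nrm_tri (y m) _ _) _.
by have := hN m (leq_maxr _ _); have := hm n m (leq_maxl _ _); lra.
Qed.

Lemma geometric_series V (a : nat -> X) (K : R) : is_subspace V -> closed V -> 0 <= K ->
  (forall n, V (a n)) -> (forall n, nrm (a n) <= K / 2 ^+ n) ->
  exists l, [/\ V l, nrm l <= 2 * K &
    forall n, nrm (l - \sum_(i < n) a i) <= 2 * K / 2 ^+ n].
Proof.
move=> hV /closed_nrmP cV K0 Va ha.
have K2 : 0 <= 2 * K by rewrite mulr_ge0.
have r0 n : 0 <= 2 * K / 2 ^+ n by rewrite divr_ge0 // exprn_ge0.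
have [|//|e e0|l hl] := @nested_limit (fun n => \sum_(i < n) a i) (fun n => 2 * K / 2 ^+ n).
- move=> n; rewrite big_ord_recr /= addrAC subrr add0r; apply: le_trans (ha n) _.
  rewrite exprS invfM le_eqVlt; apply/orP; left; apply/eqP; lra.
- exact: exp2_small.
exists l; split=> //.
  apply: cV => e e0; have [n hn] := exp2_small K2 e0.
  exists (\sum_(i < n) a i); first by apply: subsp_sum.
  by apply: le_lt_trans (hl n) hn.
by have := hl 0%N; rewrite big_ord0 subr0 expr0 divr1.
Qed.

(* Solving [y = G x + z] up to half the size of [y] suffices: iterate on the remainder. *)
Lemma approx_solve G V Z Q (C : R) : bop G -> is_subspace V -> closed V ->
  is_subspace Z -> closed Z -> 0 <= C ->
  (forall y, Q y -> exists x z, [/\ V x, Z z, nrm x <= C * nrm y, nrm z <= C * nrm y &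
     Q (y - G x - z) /\ nrm (y - G x - z) <= nrm y / 2]) ->
  forall y, Q y -> exists x z,
    [/\ V x, Z z, y = G x + z, nrm x <= 2 * C * nrm y & nrm z <= 2 * C * nrm y].
Proof.
move=> [lG [L L0 hL]] hV cV hZ cZ C0 h y Qy.
have /choice [f hf] : forall y, exists p : X * X, Q y ->
   [/\ V p.1, Z p.2, nrm p.1 <= C * nrm y, nrm p.2 <= C * nrm y &
     Q (y - G p.1 - p.2) /\ nrm (y - G p.1 - p.2) <= nrm y / 2].
  move=> y'; have [/h [x [z ?]]|] := pselect (Q y'); first by exists (x, z).
  by exists (0, 0).
pose g y := y - G (f y).1 - (f y).2.
pose r n := iter n g y.
have Qr n : Q (r n) by elim: n => [//|n /hf []] _ _ _ _ [].
have nr n : nrm (r n) <= nrm y / 2 ^+ n.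
  elim: n => [|n IH]; first by rewrite expr0 divr1.
  have [_ _ _ _ [_ hn]] := hf _ (Qr n).
  apply: le_trans hn _; rewrite exprS invfM mulrCA [_^-1 * _]mulrC.
  by rewrite ler_wpM2r // invr_ge0.
have Cy : 0 <= C * nrm y by rewrite mulr_ge0 // nrm_ge0.
have bnd n (x : X) : nrm x <= C * nrm (r n) -> nrm x <= C * nrm y / 2 ^+ n.
  by move=> hx; apply: le_trans hx _; rewrite -mulrA ler_wpM2l.
have [n|n|s [Vs ns hs]] := @geometric_series V (fun n => (f (r n)).1) _ hV cV Cy.
- by have [] := hf _ (Qr n).
- by apply: bnd; have [] := hf _ (Qr n).
have [n|n|t [Zt nt ht]] := @geometric_series Z (fun n => (f (r n)).2) _ hZ cZ Cy.
- by have [] := hf _ (Qr n).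
- by apply: bnd; have [] := hf _ (Qr n).
exists s, t; split=> //; rewrite -?mulrA //.
apply/eqP; rewrite -subr_eq0; apply/eqP; apply: nrm_sub_small => e e0.
have rE n : r n = y - G (\sum_(i < n) (f (r i)).1) - \sum_(i < n) (f (r i)).2.
  elim: n => [|n IH]; first by rewrite !big_ord0 (lin0 lG) !subr0.
  rewrite !big_ord_recr /= (linD _ _ lG) [LHS]/g -/(r n) {1}IH.
  by rewrite !opprD !addrA; congr (_ - _); rewrite addrAC.
have K0 : 0 <= nrm y + L * (2 * (C * nrm y)) + 2 * (C * nrm y).
  by rewrite !addr_ge0 ?nrm_ge0 ?mulr_ge0 ?(ltW L0) ?nrm_ge0.
have [n hn] := exp2_small K0 e0; apply: le_lt_trans hn.
have -> : y - (G s + t) = r n - G (s - \sum_(i < n) (f (r i)).1) - (t - \sum_(i < n) (f (r i)).2).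
  rewrite rE (linB _ _ lG); set a := G (\sum_(i < n) _); set b := \sum_(i < n) _.
  by rewrite !opprB !opprD !addrA [y - a - b + a]addrAC subrK [y - b - _]addrAC subrK.
apply: le_trans (nrmB _ _) _.
have h1 := nrmB (r n) (G (s - \sum_(i < n) (f (r i)).1)).
have h2 := nr n.
have h3 := hL (s - \sum_(i < n) (f (r i)).1).
have h4 : L * nrm (s - \sum_(i < n) (f (r i)).1) <= L * (2 * (C * nrm y) / 2 ^+ n).
  by rewrite ler_wpM2l // ltW.
have h5 := ht n.
rewrite !mulrDl -[L * _ / _]mulrA; lra.
Qed.

(** If no [E n] were dense in a relative ball of [Q], there would be nested balls, given by pairs of
    centre and radius, whose centres stay two radii away from the successive [E n]; the limit of the
    centres would lie in no [E n]. *)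
Lemma baire_closed Q (E : nat -> set X) q : closed Q -> Q q ->
  (forall y, Q y -> exists n, E n y) ->
  exists n y0 (r : R), [/\ Q y0, 0 < r & forall y, Q y -> nrm (y - y0) < r ->
    forall e : R, 0 < e -> exists2 w, E n w & nrm (y - w) < e].
Proof.
move=> /closed_nrmP cQ Qq hE; apply: contrapT => hN.
have st (n : nat) (s : X * R) : exists s' : X * R, Q s.1 -> 0 < s.2 ->
   [/\ Q s'.1, 0 < s'.2, s'.2 <= s.2 / 2, nrm (s'.1 - s.1) <= s.2 / 2 &
     forall w, E n w -> 2 * s'.2 <= nrm (s'.1 - w)].
  have [[Qs s0]|hs] := pselect (Q s.1 /\ 0 < s.2); last first.
    by exists s => ? ?; case: hs.
  apply: contrapT => h; apply: hN; exists n, s.1, (s.2 / 2).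
  split=> //; first by rewrite divr_gt0.
  move=> y Qy ys e e0; apply: contrapT => h'; apply: h.
  exists (y, Num.min (s.2 / 2) (e / 2)) => _ _ /=; split => //.
  - by rewrite lt_min !divr_gt0.
  - by rewrite ge_min lexx.
  - exact: ltW.
  move=> w Ew; rewrite leNgt; apply/negP => hw; apply: h'; exists w => //.
  apply: lt_le_trans hw _.
  have : Num.min (s.2 / 2) (e / 2) <= e / 2 by rewrite ge_min lexx orbT.
  lra.
have /choice [f hf] : forall ns : nat * (X * R), exists s' : X * R, Q ns.2.1 -> 0 < ns.2.2 ->
   [/\ Q s'.1, 0 < s'.2, s'.2 <= ns.2.2 / 2, nrm (s'.1 - ns.2.1) <= ns.2.2 / 2 &
     forall w, E ns.1 w -> 2 * s'.2 <= nrm (s'.1 - w)] by move=> [n s]; apply: st.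
pose fix s n : X * R := if n is m.+1 then f (m, s m) else (q, 1).
have hs n : Q (s n).1 /\ 0 < (s n).2.
  by elim: n => [|n [h1 h2]] //=; have [] := hf (n, s n) h1 h2.
have hS n := hf (n, s n) (hs n).1 (hs n).2.
have s2 n : (s n).2 <= 1 / 2 ^+ n.
  elim: n => [|n IH]; first by rewrite expr0 divr1.
  have [_ _ h _ _] := hS n; apply: le_trans h _.
  by rewrite exprS invfM /=; move: IH; lra.
have [n|n|e e0|l hl] := @nested_limit (fun n => (s n).1) (fun n => (s n).2).
- by have [_ _ h1 h2 _] := hS n; move: h1 h2 => /=; lra.
- exact: ltW (hs n).2.
- by have [n hn] := exp2_small ler01 e0; exists n; apply: le_lt_trans hn.
have Ql : Q l.
  apply: cQ => e e0; have [n hn] := exp2_small ler01 e0.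
  exists (s n).1; first by case: (hs n).
  by apply: le_lt_trans (hl n) _; apply: le_lt_trans hn.
have [n El] := hE _ Ql; have [_ h _ _ /(_ _ El)] := hS n.
by have := hl n.+1; rewrite nrmC /= => h1 h2; move: h h1 h2 => /=; lra.
Qed.

(** The summand [Z] makes one statement serve three uses: [Z = 0] bounds preimages, a complement [Z]
    of a range yields closedness, and [G = id] bounds the projections of a direct sum. *)
Lemma open_mapping G V Z Q : bop G -> is_subspace V -> closed V ->
  is_subspace Z -> closed Z -> is_subspace Q -> closed Q ->
  (forall x, V x -> Q (G x)) -> Z `<=` Q ->
  (forall y, Q y -> exists x z, [/\ V x, Z z & y = G x + z]) ->
  exists2 C : R, 0 < C & forall y, Q y -> exists x z,
    [/\ V x, Z z, y = G x + z, nrm x <= C * nrm y & nrm z <= C * nrm y].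
Proof.
move=> bG hV cV hZ cZ hQ cQ GQ ZQ hs; have lG := bG.1.
pose E (k : nat) := [set y | exists x z, [/\ V x, Z z, y = G x + z, nrm x <= k%:R & nrm z <= k%:R]].
have [|n [y0 [r [Qy0 r0 h]]]] := @baire_closed Q E 0 cQ (subsp0 hQ).
  move=> y /hs [x [z [Vx Zz ->]]].
  exists (maxn (Num.bound (nrm x)) (Num.bound (nrm z))), x, z; split=> //.
    apply/ltW/(lt_le_trans (archi_boundP (nrm_ge0 _))).
    by rewrite ler_nat leq_maxl.
  apply/ltW/(lt_le_trans (archi_boundP (nrm_ge0 _))).
  by rewrite ler_nat leq_maxr.
pose C : R := 8 * n.+1%:R / r.
have nn0 : (0 : R) <= n%:R by [].
have C0 : 0 < C by rewrite divr_gt0 // mulr_gt0.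
exists (2 * C); first by rewrite mulr_gt0.
apply: approx_solve => //; first exact: ltW.
move=> y Qy; have [y00|/nrm_gt0 ny] := pselect (y = 0).
  exists 0, 0; rewrite y00 (lin0 lG) !subr0 !nrm0 mulr0 mul0r.
  by split=> //; [apply: subsp0|apply: subsp0|split => //; apply: subsp0].
(* [t] brings [y] to length [r / 2]. Approximating [y0 + t *: y] and [y0] within [r / 8]
   approximates the difference within [r / 4], half its length. *)
pose t := r / (2 * nrm y).
have t0 : 0 < t by rewrite divr_gt0 // mulr_gt0.
have nty : nrm (t%:C *: y) = r / 2.
  by rewrite nrmZ md_real gtr0_norm // /t; field; rewrite gt_eqF.
have r8 : 0 < r / 8 by rewrite divr_gt0.
have [||w1 [x1 [z1 [Vx1 Zz1 -> nx1 nz1]]] hw1] := h (y0 + t%:C *: y) _ _ _ r8.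
- by apply: subspD => //; apply: subspZ.
- by rewrite addrC addKr nty; lra.
have [||w2 [x2 [z2 [Vx2 Zz2 -> nx2 nz2]]] hw2] := h y0 _ _ _ r8.
- by [].
- by rewrite subrr nrm0.
exists ((t^-1)%:C *: (x1 - x2)), ((t^-1)%:C *: (z1 - z2)).
have tC : nrm y * C = 4 * n.+1%:R / t.
  by rewrite /C /t; field; rewrite !gt_eqF.
have bnd (a b : X) : nrm a <= n%:R -> nrm b <= n%:R -> nrm ((t^-1)%:C *: (a - b)) <= C * nrm y.
  move=> ha hb; rewrite nrmZ md_real gtr0_norm ?invr_gt0 // [C * _]mulrC tC mulrC.
  rewrite ler_wpM2r ?invr_ge0 ?(ltW t0) //; apply: le_trans (nrmB _ _) _.
  by rewrite -natr1; move: ha hb nn0; lra.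
have Vx : V ((t^-1)%:C *: (x1 - x2)) by apply: subspZ => //; apply: subspB.
have Zz : Z ((t^-1)%:C *: (z1 - z2)) by apply: subspZ => //; apply: subspB.
split=> //; [exact: bnd|exact: bnd|split].
  by apply: subspB (ZQ _ Zz) => //; apply: subspB (GQ _ Vx).
have -> : y - G ((t^-1)%:C *: (x1 - x2)) - (t^-1)%:C *: (z1 - z2) =
  (t^-1)%:C *: ((y0 + t%:C *: y - (G x1 + z1)) - (y0 - (G x2 + z2))).
  rewrite (linZ _ _ lG) (linB _ _ lG) -addrA -opprD -scalerDr.
  rewrite addrACA -opprD [in RHS]opprB [in RHS]addrC -[y0 + _ - _]addrA addrA subrK.
  rewrite addrCA [RHS]scalerDr scalerA -rmorphM /= mulVf ?gt_eqF // scale1r.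
  by rewrite -scalerN opprB.
rewrite nrmZ md_real gtr0_norm ?invr_gt0 //.
have -> : nrm y / 2 = t^-1 * (r / 4) by rewrite /t; field; rewrite !gt_eqF.
rewrite ler_wpM2l ?invr_ge0 ?(ltW t0) //; apply: le_trans (nrmB _ _) _.
by move: hw1 hw2; lra.
Qed.

End OpenMapping.

(** * Closed ranges, finite complements and direct sums *)

Section Ranges.
Variable R : realType.
Variable X : completeNormedModType R[i].
Implicit Types (A B M V W Q Z : set X) (x y z w : X) (F G : X -> X).

Lemma closed_sub_lim A x : closed A ->
  (forall e : R, 0 < e -> exists2 a, A a & nrm (x - a) < e) -> A x.
Proof. by move/closed_nrmP; apply. Qed.

Lemma closed_set0 : closed [set (0 : X)].
Proof.
apply/closed_nrmP => x h; apply: nrm_sub_small => e /h [_ ->].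
by rewrite subr0.
Qed.

Lemma bop_id : bop (id : X -> X).
Proof. by split=> //; exists 1 => // x; rewrite mul1r. Qed.

Lemma bop_comp F G : bop F -> bop G -> bop (F \o G).
Proof.
move=> [lF [L L0 hL]] [lG [K K0 hK]]; split.
  by split=> [x y|a x] /=; rewrite ?(linD _ _ lG) ?(linD _ _ lF) ?(linZ _ _ lG) ?(linZ _ _ lF).
exists (L * K); first exact: mulr_gt0.
by move=> x /=; apply: le_trans (hL _) _; rewrite -mulrA ler_wpM2l // ltW.
Qed.

Lemma bop_iter F n : bop F -> bop (iter n F).
Proof. by move=> bF; elim: n => [|n IH]; [exact: bop_id|exact: (bop_comp bF IH)]. Qed.

Lemma bop_shift F l : bop F -> bop (shift F l).
Proof.
move=> [lF [L L0 hL]]; split; first exact: lin_shift.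
exists (L + md l); first by apply: ltr_wpDr => //; apply: md_ge0.
by move=> x; apply: le_trans (nrmB _ _) _; rewrite nrmZ mulrDl lerD2r.
Qed.

(** The inverse of [F] modulo its kernel is bounded; preimages stand in for the quotient norm. *)
Definition range_bound V F (C : R) :=
  forall x, V x -> exists x', [/\ V x', F x' = F x & nrm x' <= C * nrm (F x)].

Lemma closed_range_bound V F : bop F -> is_subspace V -> closed V -> closed (rngM V F) ->
  exists2 C : R, 0 < C & range_bound V F C.
Proof.
move=> bF hV cV cR; have hR : is_subspace (rngM V F) by apply: subsp_img bF.1 hV.
have [|||C C0 h] := @open_mapping _ _ F V [set 0] (rngM V F) bF hV cV (@subsp_set0 _ _) closed_set0 hR cR.
- by move=> x Vx; exists x.
- by move=> _ ->; apply: subsp0.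
- by move=> _ [x Vx <-]; exists x, 0; rewrite addr0.
exists C => // x Vx; have [|x' [z [Vx' -> e h1 _]]] := h (F x); first by exists x.
by exists x'; split=> //; rewrite e addr0.
Qed.

(** A point [y] of the closure is within [|y| / 2] of a value of [F], of norm at most [2 |y|]. Run
    on the closure of the range, [approx_solve] turns this into an exact solution. *)
Lemma range_bound_closed V F (C : R) : bop F -> is_subspace V -> closed V -> 0 < C ->
  range_bound V F C -> closed (rngM V F).
Proof.
move=> bF hV cV C0 h; apply/closed_nrmP => y0 hy0.
pose Q y := forall e : R, 0 < e -> exists2 a, rngM V F a & nrm (y - a) < e.
have [||x [z [Vx -> -> _ _]]] := @approx_solve _ _ F V [set 0] Q (2 * C) bF hV cV (@subsp_set0 _ _) closed_set0 _ _ y0 hy0.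
- by rewrite mulr_ge0 // ltW.
- move=> y Qy; have [->|/nrm_gt0 ny] := pselect (y = 0).
    exists 0, 0; rewrite (lin0 bF.1) !subr0 !nrm0 mulr0 mul0r; split=> //.
      exact: subsp0.
    split=> // e e0; exists 0; last by rewrite subr0 nrm0.
    by exists 0; [exact: subsp0|exact: lin0 bF.1].
  have [|_ [x1 Vx1 <-] hx1] := Qy (nrm y / 2); first by rewrite divr_gt0.
  have [x [Vx Fx nx]] := h _ Vx1; exists x, 0; split=> //.
  + have n1 : nrm (F x1) <= 2 * nrm y.
      by have := nrm_sub_le (F x1) y; rewrite nrmC; move: hx1 ny; lra.
    by move: (ler_wpM2l (ltW C0) n1) nx; lra.
  + by rewrite nrm0 !mulr_ge0 // ltW.
  rewrite subr0 Fx; split; last exact: ltW.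
  move=> e e0; have [_ [u Vu <-] hu] := Qy _ e0; exists (F (u - x1)).
    by exists (u - x1) => //; apply: subspB.
  by rewrite (linB _ _ bF.1) opprB addrA subrK.
- by exists x; rewrite ?addr0.
Qed.

(** A complement of the larger space [addline B w] is enlarged by [w]. *)
Lemma finite_complement V B k : is_subspace V -> is_subspace B -> B `<=` V ->
  codim_le V B k -> exists Z, [/\ is_subspace Z, closed Z, Z `<=` V,
    Z `&` B `<=` [set 0] & V `<=` addsp B Z].
Proof.
move=> hV; elim: k B => [|k IH] B hB BV h.
  exists [set 0]; split=> //.
  - exact: subsp_set0.
  - exact: closed_set0.
  - by move=> _ ->; apply: subsp0.
  - by move=> x Vx; apply: addspl; [exact: subsp_set0|move/codim_le0: h; apply].
have [VB|] := pselect (V `<=` B).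
  by apply: IH => //; apply: (@codim_le_leq _ _ _ _ 0) => //; apply/codim_le0.
move/existsNP => [w /not_implyP [Vw Bw]].
have [|||Z [hZ cZ ZV ZB VZ]] := IH (addline B w).
- exact: subsp_addline.
- by apply: addsp_sub => // _ [c ->]; apply: subspZ.
- exact: codim_le_exchange.
exists (addline Z w); split.
- exact: subsp_addline.
- exact: closed_addline.
- by apply: addsp_sub => // _ [c ->]; apply: subspZ.
- move=> x [/addlineP [c Zx] Bx].
  have xc : x - c *: w = 0.
    apply: ZB; split=> //; apply/addlineP; exists (- c).
    by rewrite scaleNr opprK subrK.
  have xE : x = c *: w by apply/eqP; rewrite -subr_eq0 xc.
  have [c0|c0] := eqVneq c 0; first by rewrite xE c0 scale0r.
  by case: Bw; apply: (subspZE hB c0); rewrite -xE.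
- move=> x /VZ [a [z [/addlineP [c Bc] Zz ->]]].
  exists (a - c *: w), (c *: w + z); split=> //.
    by apply/addlineP; exists c; rewrite addrAC subrr add0r.
  by rewrite addrA subrK.
Qed.

(** With a complement [Z] of the range, the component in [Z] of a vector of [Q] is unique and
    bounded by its norm; at a limit of values of [F] it vanishes. *)
Lemma fincodim_range_closed V Q F k : bop F -> is_subspace V -> closed V ->
  is_subspace Q -> closed Q -> (forall x, V x -> Q (F x)) ->
  codim_le Q (rngM V F) k -> closed (rngM V F).
Proof.
move=> bF hV cV hQ cQ FQ h.
have hR : is_subspace (rngM V F) by apply: subsp_img bF.1 hV.
have RQ : rngM V F `<=` Q by move=> _ [x /FQ ? <-].
have [Z [hZ cZ ZQ ZR QZ]] := finite_complement hQ hR RQ h.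
have [|C C0 hC] := open_mapping bF hV cV hZ cZ hQ cQ FQ ZQ.
  by move=> y /QZ [_ [z [[x Vx <-] Zz ->]]]; exists x, z.
apply/closed_nrmP => y hy.
have Qy : Q y.
  by apply: closed_sub_lim (cQ) _ => e /hy [a /RQ Qa ha]; exists a.
have [x [z [Vx Zz yE _ _]]] := hC _ Qy.
suff z0 : z = 0 by exists x; rewrite // yE z0 addr0.
apply: nrm_sub_small => e e0.
have [_ [u Vu <-] hu] := hy (e / C) (divr_gt0 e0 C0).
have [|x' [z' [Vx' Zz' yu _ nz']]] := hC (y - F u).
  by apply: subspB => //; apply: FQ.
suff -> : z = z'.
  by apply: le_lt_trans nz' _; rewrite mulrC -ltr_pdivlMr.
apply/eqP; rewrite -subr_eq0; apply/eqP; apply: ZR; split; first exact: subspB.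
exists (x' - (x - u)); first by apply: subspB => //; apply: subspB.
rewrite !(linB _ _ bF.1); apply/eqP; rewrite subr_eq; apply/eqP.
have -> : F x = y - z by rewrite yE addrK.
have -> : F x' = y - F u - z' by rewrite yu addrK.
by rewrite [y - z - _]addrAC [RHS]addrC addrA subrK.
Qed.

Lemma dsum_bound M N : is_subspace M -> closed M -> is_subspace N -> closed N ->
  M `&` N `<=` [set 0] -> addsp M N = setT ->
  exists2 C : R, 0 < C & forall m n, M m -> N n -> nrm m <= C * nrm (m + n) /\ nrm n <= C * nrm (m + n).
Proof.
move=> hM cM hN cN MN MNT.
have [|||C C0 h] := @open_mapping _ _ id M N setT bop_id hM cM hN cN (@subsp_setT _ _) closedT.
- by [].
- by [].
- by move=> y _; have [a [b [? ? ?]]] : addsp M N y by [rewrite MNT]; exists a, b.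
exists C => // m n Mm Nn; have [//|m' [n' [Mm' Nn' e h1 h2]]] := h (m + n).
have mm : m - m' = n' - n.
  by apply/eqP; rewrite subr_eq addrAC [n' + _]addrC -e addrK.
have m0 : m - m' = 0 by apply: MN; split; [exact: subspB|rewrite mm; exact: subspB].
have -> : m = m' by apply/eqP; rewrite -subr_eq0 m0.
rewrite {}mm in m0.
have <- : n' = n by apply/eqP; rewrite -subr_eq0 m0.
by rewrite /= in e h1 h2; rewrite -e.
Qed.

Lemma closed_dsum M N A B : is_subspace M -> closed M -> is_subspace N -> closed N ->
  M `&` N `<=` [set 0] -> addsp M N = setT ->
  is_subspace A -> is_subspace B -> A `<=` M -> B `<=` N ->
  closed A -> closed B -> closed (addsp A B).
Proof.
move=> hM cM hN cN MN MNT hA hB AM BN cA cB.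
have [C C0 hC] := dsum_bound hM cM hN cN MN MNT.
apply/closed_nrmP => y hy.
have [m [n [Mm Nn yE]]] : addsp M N y by rewrite MNT.
have key (e : R) : 0 < e -> exists a b, [/\ A a, B b, nrm (m - a) < e & nrm (n - b) < e].
  move=> e0; have [_ [a [b [Aa Bb ->]]] hab] := hy (e / C) (divr_gt0 e0 C0).
  exists a, b; split=> //.
    have [h _] := hC (m - a) (n - b) (subspB hM Mm (AM _ Aa)) (subspB hN Nn (BN _ Bb)).
    apply: le_lt_trans h _; rewrite mulrC -ltr_pdivlMr //.
    by rewrite addrACA -opprD -yE.
  have [_ h] := hC (m - a) (n - b) (subspB hM Mm (AM _ Aa)) (subspB hN Nn (BN _ Bb)).
  apply: le_lt_trans h _; rewrite mulrC -ltr_pdivlMr //.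
  by rewrite addrACA -opprD -yE.
exists m, n; split=> //.
  by apply: closed_sub_lim (cA) _ => e /key [a [b [? _ ? _]]]; exists a.
by apply: closed_sub_lim (cB) _ => e /key [a [b [_ ? _ ?]]]; exists b.
Qed.

End Ranges.

(** * Kato operators under small shifts *)

Section KatoStability.
Variable R : realType.
Variable X : completeNormedModType R[i].
Implicit Types (A B M V W Q Z : set X) (x y z w : X) (F G : X -> X) (C : R) (l : R[i]).

(** [C] is explicit because the admissible size of a shift is measured by [C * md l]. *)
Definition kato_bound V F C : Prop :=
  [/\ 0 < C, range_bound V F C & forall n, kerM V F `<=` rngM V (iter n F)].

Lemma KatoP V F : bop F -> is_subspace V -> closed V ->
  Kato V F <-> exists C, kato_bound V F C.
Proof.
move=> bF hV cV; split=> [[cR hK]|[C [C0 hC hK]]].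
  by have [C C0 hC] := closed_range_bound bF hV cV cR; exists C.
by split=> //; apply: range_bound_closed hC.
Qed.

Lemma subsp_rng_iter V F n : lin F -> is_subspace V -> is_subspace (rngM V (iter n F)).
Proof. by move=> lF; apply: subsp_img; apply: lin_iter. Qed.

Lemma rng_iter_inv V F n : invariant V F -> invariant (rngM V (iter n F)) F.
Proof.
move=> iV _ [x Vx <-]; exists (F x); first exact: iV.
by rewrite -iterSr.
Qed.

(* [F - l] with [l != 0] is injective modulo the range of [F^n], on which [F] acts nilpotently. *)
Lemma rng_iter_shift V F n l w : lin F -> is_subspace V -> invariant V F -> l != 0 ->
  V w -> rngM V (iter n F) (shift F l w) -> rngM V (iter n F) w.
Proof.
move=> lF hV iV l0 Vw; elim: n => [|n IH] h; first by exists w.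
have hn : rngM V (iter n F) w by apply: IH; apply: rng_iter_sub h.
have hR := subsp_rng_iter n.+1 lF hV.
apply: (subspZE hR l0); have -> : l *: w = F w - shift F l w by rewrite /shift opprB addrC subrK.
by apply: subspB => //; rewrite rng_iterS; exists w.
Qed.

Definition hyperrange V F : set X := [set y | forall n, rngM V (iter n F) y].

Lemma hyperrange_sub V F : hyperrange V F `<=` V.
Proof. by move=> y /(_ 0%N) [x Vx <-]. Qed.

Lemma subsp_hyperrange V F : lin F -> is_subspace V -> is_subspace (hyperrange V F).
Proof.
move=> lF hV; split=> [n|]; first exact: subsp0 (subsp_rng_iter n lF hV).
by split=> [x y hx hy n|a x hx n]; have hR := subsp_rng_iter n lF hV;
  [apply: subspD|apply: subspZ].
Qed.

(** For [l != 0] this is [rng_iter_shift]. For [l = 0], [w] and some [F^n z] have the same image, so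
    they differ by a kernel vector, which lies in every range. *)
Lemma hyperrange_shift V F l w : lin F -> is_subspace V -> invariant V F ->
  (forall n, kerM V F `<=` rngM V (iter n F)) ->
  V w -> hyperrange V F (shift F l w) -> hyperrange V F w.
Proof.
move=> lF hV iV hK Vw h n; have hR := subsp_rng_iter n lF hV.
have [l0|l0] := eqVneq l 0; last exact: rng_iter_shift (h n).
move: h; rewrite l0 shift0 => /(_ n.+1) [z Vz hz].
rewrite -(subrK (iter n F z) w); apply: subspD => //; last by exists z.
apply: hK; split; first by apply: subspB => //; apply: invariant_iter.
by rewrite /= (linB _ _ lF) -hz subrr.
Qed.

Section Perturbation.
Variables (V : set X) (F : X -> X) (C : R).
Hypotheses (hV : is_subspace V) (cV : closed V) (bF : bop F) (iV : invariant V F).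
Hypothesis (hC : kato_bound V F C).

Let lF := bF.1.
Let C0 : 0 < C. Proof. by case: hC. Qed.
Let Cb : range_bound V F C. Proof. by case: hC. Qed.
Let hK : forall n, kerM V F `<=` rngM V (iter n F). Proof. by case: hC. Qed.

(** A preimage [x] under [F] solves the equation for [F - l] up to [l *: x], at most half of [y].
    The series converges in the closed space [V], and [hyperrange_shift] brings its sum back into
    the hyper-range, which is not known to be closed. *)
Lemma hyperrange_solve l y : C * md l <= 1 / 2 -> hyperrange V F y ->
  exists w, [/\ hyperrange V F w, shift F l w = y & nrm w <= 2 * C * nrm y].
Proof.
move=> hl hy.
have [|y' hy'|w [z [Vw z0 yE nw _]]] := @approx_solve _ _ (shift F l) V [set 0] (hyperrange V F) C
    (bop_shift l bF) hV cV (@subsp_set0 _ _) (@closed_set0 _ _) _ _ y hy.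
- exact: ltW.
- have [x1 Vx1 /= Fx1] := hy' 1%N; have [x [Vx Fx nx]] := Cb Vx1.
  have hx : hyperrange V F x.
    by apply: (@hyperrange_shift _ _ 0) => //; rewrite shift0 Fx Fx1.
  exists x, 0; rewrite -Fx1 /= nrm0 subr0 /shift Fx opprB addrC subrK; split=> //.
    by rewrite mulr_ge0 ?nrm_ge0 // ltW.
  split; first exact: subspZ (subsp_hyperrange lF hV) hx.
  rewrite nrmZ; have h1 : md l * nrm x <= md l * (C * nrm (F x1)) by rewrite ler_wpM2l // md_ge0.
  by have := ler_wpM2r (nrm_ge0 (F x1)) hl; move: h1; lra.
rewrite z0 addr0 in yE; exists w; split=> //.
by apply: (@hyperrange_shift _ _ l) => //; rewrite -yE.
Qed.

Lemma ker_shift_hyperrange l : kerM V (shift F l) `<=` hyperrange V F.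
Proof.
move=> v [Vv /= h]; apply: (@hyperrange_shift _ _ l) => //.
by rewrite h; apply: subsp0; apply: subsp_hyperrange.
Qed.

(** The kernel lies in the hyper-range of [F], which [F - l] maps onto itself. *)
Lemma ker_shift_sub_rng l n : C * md l <= 1 / 2 ->
  kerM V (shift F l) `<=` rngM V (iter n (shift F l)).
Proof.
move=> hl v /ker_shift_hyperrange; elim: n v => [|n IH] v hv.
  by exists v => //; apply: hyperrange_sub hv.
have [w [/IH [u Vu uw] <- _]] := hyperrange_solve hl hv.
by rewrite rng_iterS; exists w => //; exists u.
Qed.

Lemma gap_ker_shift l : C * md l <= 1 / 2 ->
  gap_le (kerM V F) (kerM V (shift F l)) (2 * (C * md l)).
Proof.
move=> hl u [Vu /= Fu].
have hu : hyperrange V F u by move=> n; apply: hK.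
have [w [hw wu nw]] := hyperrange_solve hl hu.
(* [F - l] sends [u] to [- l *: u] and [w] to [u]. *)
exists (u + l *: w).
  split; first by apply: subspD => //; apply: subspZ => //; apply: hyperrange_sub hw.
  rewrite /= (linD _ _ (lin_shift l lF)) (linZ _ _ (lin_shift l lF)) wu.
  by rewrite /shift Fu sub0r addNr.
rewrite opprD addrA subrr sub0r nrmN nrmZ.
by move: (ler_wpM2l (md_ge0 l) nw); lra.
Qed.

Lemma gap_shift_ker l : gap_le (kerM V (shift F l)) (kerM V F) (C * md l).
Proof.
move=> v [Vv /= hv]; have Fv : F v = l *: v by apply/eqP; rewrite -subr_eq0; apply/eqP.
have [x [Vx Fx nx]] := Cb Vv.
exists (v - x); first by split; [exact: subspB|rewrite /= (linB _ _ lF) Fx subrr].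
by rewrite opprB addrC subrK; move: nx; rewrite Fv nrmZ mulrA.
Qed.

(** Any solution [x] can be replaced by one of norm at most [2 C |y| + |x| / 2]. Iteration
    approaches the bound [4 C |y|]; the constant 5 allows stopping after finitely many steps. *)
Lemma range_bound_shift l : C * md l <= 1 / 8 -> range_bound V (shift F l) (5 * C).
Proof.
move=> hl x0 Vx0; set y := shift F l x0.
have hl2 : C * md l <= 1 / 2 by lra.
have step x : V x -> shift F l x = y -> exists x', [/\ V x', shift F l x' = y &
   nrm x' <= 2 * (C * nrm y) + nrm x / 2].
  move=> Vx xy; have [x' [Vx' Fx' nx']] := Cb Vx.
  have hk : kerM V F (x - x') by split; [exact: subspB|rewrite /= (linB _ _ lF) Fx' subrr].
  (* Subtracting from [x] a vector [v] of [N(F - l)] close to [x - x'] keeps it a solution and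
     leaves it near the small [x']. *)
  have [v [Vv /= hv] nv] := gap_ker_shift hl2 hk.
  exists (x - v); split; first exact: subspB.
    by rewrite (linB _ _ (lin_shift l lF)) hv subr0.
  have FE : F x = y + l *: x by rewrite -xy /shift subrK.
  have h1 : nrm (F x) <= nrm y + md l * nrm x by rewrite FE -nrmZ nrmD.
  have h2 := ler_wpM2l (ltW C0) h1.
  have h3 := nrmB x x'.
  have h4 : C * md l * nrm (x - x') <= C * md l * (nrm x + nrm x').
    by rewrite ler_wpM2l // mulr_ge0 ?md_ge0 // ltW.
  have h5 : C * md l * (nrm x + nrm x') <= 1 / 8 * (nrm x + nrm x').
    by rewrite ler_wpM2r // addr_ge0 ?nrm_ge0.
  have h6 : C * md l * nrm x <= 1 / 8 * nrm x by rewrite ler_wpM2r // nrm_ge0.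
  have -> : x - v = x' + (x - x' - v) by rewrite addrA [x' + _]addrC subrK.
  have h7 := nrmD x' (x - x' - v).
  have Cy : 0 <= C * nrm y by rewrite mulr_ge0 ?nrm_ge0 // ltW.
  move: nx' nv h2 h4 h5 h6 h7 (nrm_ge0 x) Cy; rewrite mulrDr mulrA; lra.
have [y0|/nrm_gt0 ny] := pselect (y = 0).
  exists 0; rewrite (lin0 (lin_shift l lF)) y0 nrm0 mulr0; split=> //; exact: subsp0.
have it n : exists x', [/\ V x', shift F l x' = y & nrm x' <= 4 * (C * nrm y) + nrm x0 / 2 ^+ n].
  elim: n => [|n [x [Vx xy nx]]].
    exists x0; split=> //; rewrite expr0 divr1.
    by rewrite lerDr !mulr_ge0 ?nrm_ge0 // ltW.
  have [x' [Vx' xy' nx']] := step _ Vx xy; exists x'; split=> //.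
  by rewrite exprS invfM; move: nx nx'; lra.
have [n hn] := exp2_small (nrm_ge0 x0) (mulr_gt0 C0 ny).
by have [x' [Vx' xy' nx']] := it n; exists x'; split=> //; move: nx' hn; lra.
Qed.

Lemma kato_bound_shift l : C * md l <= 1 / 8 -> kato_bound V (shift F l) (5 * C).
Proof.
move=> hl; split; [by rewrite mulr_gt0|exact: range_bound_shift|].
by move=> n; apply: ker_shift_sub_rng; lra.
Qed.

Lemma gap_rng_shift l : gap_le (rngM V F) (rngM V (shift F l)) (C * md l).
Proof.
move=> _ [x Vx <-]; have [x' [Vx' <- nx]] := Cb Vx.
exists (shift F l x'); first by exists x'.
by rewrite /shift opprB addrC subrK nrmZ mulrAC [_ * md l]mulrC ler_wpM2l // md_ge0.
Qed.

Lemma gap_shift_rng l : C * md l <= 1 / 8 ->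
  gap_le (rngM V (shift F l)) (rngM V F) (5 * (C * md l)).
Proof.
move=> hl _ [x Vx <-]; have [x' [Vx' <- nx]] := range_bound_shift hl Vx.
exists (F x'); first by exists x'.
rewrite {1}/shift addrAC subrr sub0r nrmN nrmZ.
by move: (ler_wpM2l (md_ge0 l) nx); lra.
Qed.

End Perturbation.

(** [gap_codim_le] is applied in both directions to kernels and to ranges. The largest of the four
    gaps is [5 * (C * md l)], hence [d / 5]; the bound 1/8 comes from [kato_bound_shift]. *)
Lemma kato_local k : exists2 d : R, 0 < d & forall V F C l,
  is_subspace V -> closed V -> bop F -> invariant V F -> kato_bound V F C -> C * md l <= d ->
  (codim_le (kerM V F) [set 0] k <-> codim_le (kerM V (shift F l)) [set 0] k) /\
  (codim_le V (rngM V F) k <-> codim_le V (rngM V (shift F l)) k).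
Proof.
have [d d0 hd] := gap_codim_le X k.
pose r := Num.min (d / 5) (1 / 8).
have rd : r <= d / 5 by rewrite ge_min lexx.
have r8 : r <= 1 / 8 by rewrite ge_min lexx orbT.
exists r; first by rewrite lt_min; apply/andP; split; lra.
move=> V F C l hV cV bF iV hC hl.
have l8 : C * md l <= 1 / 8 by lra.
have l2 : C * md l <= 1 / 2 by lra.
have bG := bop_shift l bF.
have hG := kato_bound_shift hV cV bF iV hC l8.
have s0 := @subsp_set0 _ X.
have c0 := @closed_set0 _ X.
have z0 W : is_subspace W -> [set 0] `<=` W by move=> hW _ ->; apply: subsp0.
have g00 : gap_le [set (0 : X)] [set 0] d.
  by move=> _ ->; exists 0; rewrite // subrr nrm0 mulr0.
have gVV : gap_le V V d.
  by move=> x Vx; exists x; rewrite // subrr nrm0 mulr_ge0 ?nrm_ge0 // ltW.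
have kF := subsp_ker bF.1 hV; have kG := subsp_ker bG.1 hV.
have rF : is_subspace (rngM V F) := subsp_img bF.1 hV.
have rG : is_subspace (rngM V (shift F l)) := subsp_img bG.1 hV.
have cF : closed (rngM V F) by case: hC => C0 hb _; apply: range_bound_closed hb.
have cG : closed (rngM V (shift F l)) by case: hG => C0 hb _; apply: range_bound_closed hb.
have sF : rngM V F `<=` V by move=> _ [x /iV Vx <-].
have sG : rngM V (shift F l) `<=` V by move=> _ [x Vx <-]; apply: invariant_shift.
have Cl : 0 <= C * md l by case: hC => C0 _ _; rewrite mulr_ge0 ?md_ge0 // ltW.
split; split=> h; apply: hd h => //; try exact: z0.
- by apply: (@gap_le_weaken _ _ _ _ (C * md l)); [lra|exact: gap_shift_ker].
- by apply: (@gap_le_weaken _ _ _ _ (2 * (C * md l))); [lra|exact: gap_ker_shift].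
- by apply: (@gap_le_weaken _ _ _ _ (C * md l)); [lra|exact: gap_rng_shift].
- by apply: (@gap_le_weaken _ _ _ _ (5 * (C * md l))); [lra|exact: gap_shift_rng].
Qed.

(* Walk from [0] to [l] in steps so short that [kato_local] applies, with the uniform constant
   [5 * C], to each of them. *)
Lemma kato_stable V F C l : is_subspace V -> closed V -> bop F -> invariant V F ->
  kato_bound V F C -> C * md l <= 1 / 8 -> forall k,
  (codim_le (kerM V F) [set 0] k <-> codim_le (kerM V (shift F l)) [set 0] k) /\
  (codim_le V (rngM V F) k <-> codim_le V (rngM V (shift F l)) k).
Proof.
move=> hV cV bF iV hC hl k; have [d d0 hd] := kato_local k.
have C0 : 0 < C by case: hC.
have Cl : 0 <= C * md l by rewrite mulr_ge0 ?md_ge0 // ltW.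
(* A step has length [md l / N], so that its product with [5 * C] is at most [d]. *)
pose N := (Num.bound (5 * (C * md l) / d)).+1.
have N0 : (0 : R) < N%:R by rewrite ltr0n.
have hN : 5 * (C * md l) / d <= N%:R.
  apply/ltW/(lt_le_trans (archi_boundP _)); last by rewrite ler_nat.
  by apply: divr_ge0; [exact: mulr_ge0|exact: ltW].
pose p j : R[i] := (j%:R / N%:R : R)%:C * l.
suff key j : (j <= N)%N ->
    (codim_le (kerM V F) [set 0] k <-> codim_le (kerM V (shift F (p j))) [set 0] k) /\
    (codim_le V (rngM V F) k <-> codim_le V (rngM V (shift F (p j))) k).
  by have := key N (leqnn _); rewrite /p divff ?gt_eqF // mul1r.
elim: j => [_|j IH jN]; first by rewrite /p mul0r mul0r shift0.
have pj : C * md (p j) <= 1 / 8.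
  apply: le_trans hl; rewrite ler_wpM2l ?(ltW C0) // /p mdM md_real ger0_norm ?divr_ge0 //.
  by rewrite ler_piMl ?md_ge0 // ler_pdivrMr // mul1r ler_nat ltnW.
have hj := kato_bound_shift hV cV bF iV hC pj.
have [IH1 IH2] := IH (ltnW jN).
have -> : p j.+1 = p j + (N%:R^-1 : R)%:C * l.
  by rewrite /p -mulrDl -rmorphD /= -natr1 mulrDl mul1r.
rewrite -shiftD IH1 IH2; apply: (hd _ _ (5 * C)) => //.
- exact: bop_shift.
- exact: invariant_shift.
rewrite mdM md_real ger0_norm ?invr_ge0 //.
move: hN; rewrite ler_pdivrMr // => hN.
have -> : 5 * C * (N%:R^-1 * md l) = 5 * (C * md l) / N%:R.
  by rewrite !mulrA mulrAC.
by rewrite ler_pdivrMr // [d * _]mulrC.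
Qed.

End KatoStability.

(** * Semi-Fredholm and Riesz operators *)

Section SemiFredholmCore.
Variable R : realType.
Variable X : completeNormedModType R[i].
Implicit Types (A B M N V W Q Z : set X) (x y z w : X) (F G : X -> X) (C : R) (l : R[i]).

Lemma codim_is_eq_sub V A B c : is_subspace B -> is_subspace A -> A `<=` B -> B `<=` V ->
  codim_is V A c -> codim_is V B c -> B `<=` A.
Proof.
move=> hB hA AB BV hVA hVB.
have [e he] : exists e, codim_is B A e.
  by apply: (@codim_is_exists _ _ _ _ c); apply: codim_le_sub (codim_is_le hVA).
have h := codim_is_uniq (codim_is_add hB hA BV AB hVB he) hVA.
have e0 : e = 0%N by apply/eqP; rewrite -(eqn_add2l c) addn0; apply/eqP.
by apply/codim_le0; rewrite e0 in he; apply: codim_is_le.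
Qed.

Lemma codim_is_sub_eq V A B c : is_subspace B -> is_subspace A -> A `<=` B -> B `<=` V ->
  codim_is V A c -> codim_is B A c -> V `<=` B.
Proof.
move=> hB hA AB BV hVA hBA.
have [e he] : exists e, codim_is V B e.
  by apply: (@codim_is_exists _ _ _ _ c); apply: codim_le_sub (codim_is_le hVA).
have h := codim_is_uniq (codim_is_add hB hA BV AB he hBA) hVA.
have e0 : e = 0%N by apply/eqP; rewrite -(eqn_add2r c) add0n; apply/eqP.
by apply/codim_le0; rewrite e0 in he; apply: codim_is_le.
Qed.

(** Used on monotone sequences: they are constant from an index of least codimension on. *)
Lemma codim_seq_min (V B : nat -> set X) k : codim_le (V 0%N) (B 0%N) k ->
  exists n c, codim_is (V n) (B n) c /\ forall m j, codim_le (V m) (B m) j -> (c <= j)%N.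
Proof.
move=> h; have e : exists c, `[< exists n, codim_le (V n) (B n) c >].
  by exists k; apply/asboolP; exists 0%N.
case: (ex_minnP e) => c /asboolP [n hn] hmin; exists n, c.
have hm m j : codim_le (V m) (B m) j -> (c <= j)%N.
  by move=> hj; apply: hmin; apply/asboolP; exists m.
by split=> // j; split=> [/hm //|cj]; apply: codim_le_leq cj hn.
Qed.

Lemma closed_codim V B k : is_subspace B -> closed B -> is_subspace V -> B `<=` V ->
  codim_le V B k -> closed V.
Proof.
move=> + + hV; elim: k B => [|k IH] B hB cB BV h.
  suff -> : V = B by [].
  by apply/seteqP; split=> //; apply/codim_le0.
have [VB|] := pselect (V `<=` B).
  by suff -> : V = B by []; apply/seteqP; split.
move/existsNP => [w /not_implyP [Vw Bw]].
apply: (IH (addline B w)).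
- exact: subsp_addline.
- exact: closed_addline.
- by apply: addsp_sub => // _ [c ->]; apply: subspZ.
- exact: codim_le_exchange.
Qed.

(** [W + N(F)] is closed, being a finite extension of [W]. As preimages are bounded modulo [N(F)], a
    limit of values of [F] on [W] has a preimage in this sum. *)
Lemma closed_img_findim_ker V W F k : bop F -> is_subspace V -> closed V ->
  closed (rngM V F) -> codim_le (kerM V F) [set 0] k ->
  is_subspace W -> closed W -> W `<=` V -> closed (F @` W).
Proof.
move=> bF hV cV cR hk hW cW WV; have lF := bF.1.
have [C C0 hC] := closed_range_bound bF hV cV cR.
have hK := subsp_ker lF hV.
have cWK : closed (addsp W (kerM V F)).
  apply: (@closed_codim _ W k) => //; [exact: subsp_add|exact: addspl|].
  move: hk => [s [sk hs]]; exists s; split=> // _ [a [b [Wa /hs [c [v [-> [sv ->]]]] ->]]].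
  by exists a, v; rewrite add0r.
apply/closed_nrmP => y hy.
have [x Vx xy] : rngM V F y.
  by apply: closed_sub_lim (cR) _ => e /hy [_ [a /WV Va <-] ha]; exists (F a) => //; exists a.
have [w [z [Ww [Vz /= Fz] xE]]] : addsp W (kerM V F) x.
  apply: closed_sub_lim (cWK) _ => e e0.
  have [_ [w Ww <-] hw] := hy (e / C) (divr_gt0 e0 C0).
  have Vxw : V (x - w) by apply: subspB => //; apply: WV.
  have [x' [Vx' Fx' nx']] := hC _ Vxw.
  exists (x - x').
    exists w, (x - w - x'); split=> //.
      by split; [exact: subspB|rewrite /= (linB _ _ lF) Fx' subrr].
    by rewrite addrA [w + _]addrC subrK.
  rewrite opprB addrC subrK; apply: le_lt_trans nx' _.
  by rewrite (linB _ _ lF) xy mulrC -ltr_pdivlMr.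
by exists w => //; rewrite -xy xE (linD _ _ lF) Fz addr0.
Qed.

Section SemiFredholm.
Variables (V : set X) (F : X -> X).
Hypotheses (hV : is_subspace V) (cV : closed V) (bF : bop F) (iV : invariant V F).
Let lF := bF.1.

Lemma codim_rng_iter k n : codim_le V (rngM V F) k -> exists d, codim_le V (rngM V (iter n F)) d.
Proof.
move=> h; elim: n => [|n [d hd]].
  by exists 0%N; apply/codim_le0 => x Vx; exists x.
exists (k + d)%N; apply: codim_le_trans h _; rewrite rng_iterS.
apply/(codim_le_img _ lF hV).
  by apply: (subsp_img lF); apply: subsp_rng_iter.
by apply: codim_le_sub hd => // x hx; exists x.
Qed.

Lemma dim_ker_iter k n : codim_le (kerM V F) [set 0] k ->
  exists d, codim_le (kerM V (iter n F)) [set 0] d.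
Proof.
move=> h; elim: n => [|n [d hd]].
  by exists 0%N; apply/codim_le0 => x [_].
have hK := subsp_ker (lin_iter n.+1 lF) hV.
exists (d + k)%N; apply: codim_le_trans _ h.
have h1 : codim_le (F @` kerM V (iter n.+1 F)) [set 0] d.
  apply: codim_le_sub hd => // _ [x [Vx /= hx] <-].
  by split; [exact: iV|rewrite /= -iterSr].
move/(codim_le_img _ lF hK (@subsp_set0 _ _)) : h1.
move/(codim_le_cap _ hK (subsp_pre lF (@subsp_set0 _ _))).
by apply: codim_le_sub => // x [[Vx _] hx].
Qed.

Lemma ker_rng_stable_plus k : codim_le (kerM V F) [set 0] k ->
  exists n, forall m, kerM V F `&` rngM V (iter n F) `<=` rngM V (iter (n + m) F).
Proof.
move=> h; pose D n := kerM V F `&` rngM V (iter n F).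
have hD n : is_subspace (D n).
  by apply: subspI; [exact: subsp_ker|exact: subsp_rng_iter].
have [|n [c [hc hmin]]] := @codim_seq_min D (fun _ => [set 0]) k.
  by apply: codim_le_sub h => // x [].
exists n => m.
have DD : D (n + m)%N `<=` D n.
  by move=> x [kx rx]; split=> //; apply: rng_iter_sub rx => //; apply: leq_addr.
suff : D n `<=` D (n + m)%N by move=> h' x /h' [].
apply: (codim_is_sub_eq (hD _) (@subsp_set0 _ _) _ DD hc).
  by move=> _ ->; apply: subsp0.
move=> j; split; first exact: hmin.
by move=> cj; apply: codim_le_leq cj _; apply: codim_le_sub (codim_is_le hc).
Qed.

(* The increasing sequence [R(F) + N(F^n)] has finite codimension, hence stabilises;
   this is dual to the stabilisation of [N(F) & R(F^n)]. *)
Lemma ker_rng_stable_minus k : codim_le V (rngM V F) k ->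
  exists n, forall m, kerM V F `&` rngM V (iter n F) `<=` rngM V (iter (n + m) F).
Proof.
move=> h; pose Z n := addsp (rngM V F) (kerM V (iter n F)).
have hR : is_subspace (rngM V F) by apply: subsp_img.
have hK n : is_subspace (kerM V (iter n F)) by apply: subsp_ker hV; apply: lin_iter.
have hZ n : is_subspace (Z n) by apply: subsp_add.
have ZV n : Z n `<=` V by apply: addsp_sub => // [_ [x /iV Vx <-]|x []].
have [|n [c [hc hmin]]] := @codim_seq_min (fun _ => V) Z k.
  by apply: codim_le_sub h => //; apply: addspl.
have ZZ m : (n <= m)%N -> Z n `<=` Z m.
  by move=> nm _ [a [b [Ra kb ->]]]; exists a, b; split=> //; apply: ker_iter_sub kb.
have ZE m : (n <= m)%N -> Z m `<=` Z n.
  move=> nm; apply: (codim_is_eq_sub (hZ _) (hZ _) (ZZ _ nm) (ZV _) hc) => j.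
  split; first exact: hmin.
  by move=> cj; apply: codim_le_leq cj _; apply: codim_le_sub (codim_is_le hc) => //; apply: ZZ.
(* If [x = F^(n+m) z] and [F x = 0], then [z] lies in [N(F^(n+m+1))], hence [z = F y + w] with
   [F^n w = 0], and [x = F^(n+m+1) y]. *)
exists n; elim=> [|m IH] x; first by rewrite addn0 => -[].
move=> hx; have kx := hx.1; have [z Vz zx] := IH _ hx.
have /ZE Zz : Z (n + m).+1 z.
  by apply: addspr => //; split=> //=; rewrite zx; case: kx.
have [_ [w [[y Vy <-] kw zE]]] := Zz (leqW (leq_addr _ _)).
have [_ /= hw] := ker_iter_sub lF (leq_addr m n) kw.
exists y => //; rewrite addnS iterSr -zx zE (linD _ _ (lin_iter _ lF)) hw addr0 //.
Qed.

(** Once [N(F) & R(F^n)] is constant, it lies in every [R(F^(n+m))], which is the range of the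
    [m]-th power of the restriction to [R(F^n)]: this is the Kato condition there. *)
Lemma semi_fredholm_core : Phi_plus V F \/ Phi_minus V F ->
  exists n C, closed (rngM V (iter n F)) /\ kato_bound (rngM V (iter n F)) F C.
Proof.
move=> hP.
have cR n : closed (rngM V (iter n F)).
  case: hP => [[/findimE [k hk] cR]|[k hk]].
    elim: n => [|n IH].
      by suff -> : rngM V (iter 0 F) = V by []; apply/seteqP; split=> [_ [x Vx <-]|x Vx] //; exists x.
    rewrite rng_iterS; apply: (closed_img_findim_ker bF hV cV cR hk) => //.
      exact: subsp_rng_iter.
    by move=> _ [x Vx <-]; apply: invariant_iter.
  have [d hd] := codim_rng_iter n hk.
  apply: (fincodim_range_closed (bop_iter n bF) hV cV hV cV _ hd).
  exact: invariant_iter.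
have [n hn] : exists n, forall m, kerM V F `&` rngM V (iter n F) `<=` rngM V (iter (n + m) F).
  by case: hP => [[/findimE [k /ker_rng_stable_plus]]|[k /ker_rng_stable_minus]].
have hY := subsp_rng_iter n lF hV.
have [C hC] : exists C, kato_bound (rngM V (iter n F)) F C.
  apply/KatoP => //; split; first by rewrite /rngM -/(rngM V (iter n F)) -rng_iterS.
  move=> m x [Yx kx].
  have [|u Vu ux] := hn m x; first by split=> //; split=> //; case: Yx => z Vz <-; apply: invariant_iter.
  by exists (iter n F u); [exists u|rewrite -iterD addnC].
by exists n, C.
Qed.

End SemiFredholm.

Definition bij V F : Prop := kerM V F `<=` [set 0] /\ V `<=` rngM V F.

(** Modulo [Y = R(F^n)] the operator [F] is nilpotent, so [F - l] is invertible there and its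
    bijectivity is decided on [Y]. On [Y], Kato stability with [k = 0] replaces [F - l] by [F]. *)
Lemma bij_shift_core V F n C l : is_subspace V -> bop F -> invariant V F ->
  closed (rngM V (iter n F)) -> kato_bound (rngM V (iter n F)) F C ->
  l != 0 -> C * md l <= 1 / 8 ->
  bij V (shift F l) <-> bij (rngM V (iter n F)) F.
Proof.
move=> hV bF iV cY hC l0 hl; have lF := bF.1; have lG := lin_shift l lF.
set Y := rngM V (iter n F).
have hY : is_subspace Y := subsp_rng_iter n lF hV.
have iY : invariant Y F := rng_iter_inv iV.
have YV : Y `<=` V by move=> _ [x Vx <-]; apply: invariant_iter.
have -> : bij Y F <-> bij Y (shift F l).
  have [h1 h2] := kato_stable hY cY bF iY hC hl 0.
  by rewrite /bij -!codim_le0 h1 h2.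
split=> -[hk hs]; split.
- by move=> x [/YV Vx kx]; apply: hk.
- move=> y /[dup] Yy /YV /hs [x Vx xy]; exists x => //.
  by apply: (rng_iter_shift lF hV iV l0) => //; rewrite xy.
- move=> x [Vx kx]; apply: hk; split=> //.
  by apply: (rng_iter_shift lF hV iV l0) => //; rewrite kx; apply: subsp0.
(* That is, [V = R(F^m) + R(F - l)]; the induction writes [u] as [l^-1 *: (F u - (F - l) u)]. *)
suff key m y : V y -> exists u x, [/\ rngM V (iter m F) u, V x & y = u + shift F l x].
  move=> y /(key n) [u [x [/hs [v /YV Vv <-] Vx ->]]].
  by exists (v + x); [exact: subspD|rewrite (linD _ _ lG)].
move=> Vy; elim: m => [|m [u [x [[z Vz zu] Vx yE]]]].
  by exists y, 0; split; [exists y|exact: subsp0|rewrite (lin0 lG) addr0].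
have Vu : V u by rewrite -zu; apply: invariant_iter.
exists (l^-1 *: F u), (x - l^-1 *: u); split.
- by apply: subspZ (subsp_rng_iter m.+1 lF hV) _; exists z; rewrite //= zu.
- by apply: subspB => //; apply: subspZ.
have FG : F u - shift F l u = l *: u by rewrite /shift opprB addrC subrK.
rewrite yE (linB _ _ lG) (linZ _ _ lG) [RHS]addrCA -scalerBr FG.
by rewrite scalerA mulVf // scale1r addrC.
Qed.

Lemma pos_below (a b : R) : 0 < a -> 0 < b -> exists q, [/\ 0 < q, q < a & q <= b].
Proof.
move=> a0 b0; exists (Num.min a b / 2).
have m0 : 0 < Num.min a b by rewrite lt_min a0.
have ma : Num.min a b <= a by rewrite ge_min lexx.
have mb : Num.min a b <= b by rewrite ge_min lexx orbT.
by split; lra.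
Qed.

(** Connectedness of [[1, +oo)] for a predicate constant on punctured neighbourhoods. Its values at
    the centres are arbitrary, so the supremum argument concerns [P], failure around a point, and
    not [b] itself. *)
Lemma real_dichotomy (b : R -> Prop) (T : R) :
  (forall t : R, 1 <= t -> exists2 r : R, 0 < r &
     (forall s, s != t -> `|s - t| < r -> b s) \/
     (forall s, s != t -> `|s - t| < r -> ~ b s)) ->
  (forall t, T < t -> b t) ->
  exists2 r : R, 0 < r & forall s, s != 1 -> `|s - 1| < r -> b s.
Proof.
move=> dich large.
pose P t := exists2 r : R, 0 < r & forall s, s != t -> `|s - t| < r -> ~ b s.
have [r r0 [h|h1]] := dich 1 (lexx _); first by exists r.
exfalso.
have P1 : P 1 by exists r.
pose S := [set t | 1 <= t /\ forall s, 1 <= s <= t -> P s].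
have PT t : T < t -> ~ P t.
  move=> Tt [p p0 hp]; apply: (hp (t + p / 2)).
  - by rewrite -subr_eq0 addrC addKr gt_eqF // divr_gt0.
  - by rewrite addrC addKr gtr0_norm ?divr_gt0 //; lra.
  - by apply: large; have := divr_gt0 p0 (ltr0Sn R 1); lra.
have S1 : S 1 by split=> // s /andP [s1 s2]; rewrite (_ : s = 1) //; apply/eqP; rewrite eq_le s2.
have hS : has_sup S.
  split; first by exists 1.
  exists (Num.max T 1 + 1) => t [t1 ht]; rewrite leNgt; apply/negP => tT.
  have hm : T <= Num.max T 1 by rewrite le_max lexx.
  by apply: (PT t); [lra|apply: ht; rewrite t1 lexx].
set u := sup S.
have u1 : 1 <= u by apply: sup_upper_bound.
have below s : 1 <= s -> s < u -> P s.
  move=> s1 su; have us0 : 0 < u - s by lra.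
  have [t [t1 ht] st] := sup_adherent us0 hS.
  by apply: ht; rewrite s1 /=; move: st; rewrite -/u; lra.
(* If [b] holds around the supremum [u], this clashes with [P t] for a [t] of [S] close to [u]; if
   it fails around [u], [S] extends beyond [u]. *)
have [p p0 [hp|hp]] := dich u u1.
  have [t [t1 ht] st] := sup_adherent p0 hS.
  have tu : t <= u by apply: sup_upper_bound.
  have [q q0 hq] : P t by apply: ht; rewrite t1 lexx.
  have pu : 0 < p - (u - t) by move: st; rewrite -/u; lra.
  have [d [d0 dq dp]] := pos_below q0 (divr_gt0 pu (ltr0Sn R 1)).
  apply: (hq (t - d)).
  - by rewrite lt_eqF //; lra.
  - by rewrite ltr0_norm; lra.
  - by apply: hp; [rewrite lt_eqF //; lra|rewrite ltr0_norm; lra].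
have : u + p / 2 <= u.
  apply: sup_upper_bound => //; split; first by lra.
  move=> s /andP [s1 sp]; have [su|su] := ltP s u; first exact: below.
  have [su'|us] := eqVneq s u; first by rewrite su'; exists p.
  have us' : u < s by rewrite lt_neqAle eq_sym us.
  (* This radius keeps the neighbourhood of [s] away from [u], where [b] is unknown. *)
  exists (Num.min (s - u) (p - (s - u))); first by rewrite lt_min; apply/andP; split; lra.
  move=> v _; rewrite lt_min => /andP [v1 v2]; apply: hp.
    apply/eqP => vu; move: v1; rewrite vu ltr0_norm; lra.
  have : `|v - u| <= `|v - s| + `|s - u| by have := ler_normD (v - s) (s - u); rewrite addrA subrK.
  rewrite [`|s - u|]gtr0_norm ?subr_gt0 //; lra.
lra.
Qed.

End SemiFredholmCore.

(** * Bijective shifts of Riesz operators *)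

Section RieszOperators.
Variable R : realType.
Variable X : completeNormedModType R[i].
Implicit Types (A B M N V W Q Z : set X) (x y z w : X) (F G S : X -> X) (C : R) (l : R[i]).

(** Neumann series: [- l^-1 *: u] solves the equation up to [l^-1 *: F u], at most half of [u]. *)
Lemma bij_shift_large V F : is_subspace V -> closed V -> bop F -> invariant V F ->
  exists2 T : R, 0 < T & forall l, T < md l -> bij V (shift F l).
Proof.
move=> hV cV bF iV; have [lF [L L0 hL]] := bF.
exists (2 * L); first by rewrite mulr_gt0.
move=> l hl.
have l0 : l != 0 by apply/eqP => l0; move: hl; rewrite l0 md0; lra.
have ml := md_gt0 l0.
have hFl x : nrm (F x) * 2 <= md l * nrm x.
  have h1 := hL x; have h2 : 2 * L * nrm x <= md l * nrm x by rewrite ler_wpM2r ?nrm_ge0 // ltW.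
  lra.
split=> [x [Vx /= hx]|y Vy].
  have Fx : F x = l *: x by apply/eqP; rewrite -subr_eq0; apply/eqP.
  have := hFl x; rewrite Fx nrmZ => h; apply: contrapT => /nrm_gt0 x0.
  by have := mulr_gt0 ml x0; lra.
have lG := lin_shift l lF.
have [||x [z [Vx -> -> _ _]]] := @approx_solve _ _ (shift F l) V [set 0] V ((md l)^-1)
    (bop_shift l bF) hV cV (@subsp_set0 _ _) (@closed_set0 _ _) _ _ y Vy.
- by rewrite invr_ge0 md_ge0.
- move=> u Vu; exists (- l^-1 *: u), 0.
  have e : u - shift F l (- l^-1 *: u) - 0 = l^-1 *: F u.
    rewrite subr0 scaleNr (linN _ lG) opprK (linZ _ _ lG) /shift scalerBr scalerA mulVf //.
    by rewrite scale1r addrC subrK.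
  rewrite e nrm0 nrmZ mdN mdV nrmZ mdV; split=> //.
  + by rewrite scaleNr; apply: subspN => //; apply: subspZ.
  + by rewrite mulr_ge0 ?invr_ge0 ?md_ge0 ?nrm_ge0.
  split; first by apply: subspZ => //; apply: iV.
  by rewrite mulrC ler_pdivrMr //; move: (hFl u); lra.
- by exists x; rewrite ?addr0.
Qed.

Section Riesz.
Variables (V : set X) (F : X -> X).
Hypotheses (hV : is_subspace V) (cV : closed V) (bF : bop F) (iV : invariant V F).
Hypothesis hF : Riesz V F.

(** The right-hand side does not depend on [e]: bijectivity is constant on a punctured disc around
    [l]. *)
Let core l : Phi_plus V (shift F l) \/ Phi_minus V (shift F l) -> exists n C, 0 < C /\
  forall e, e != 0 -> C * md e <= 1 / 8 ->
    (bij V (shift F (l + e)) <-> bij (rngM V (iter n (shift F l))) (shift F l)).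
Proof.
move=> h; have bG := bop_shift l bF; have iG := invariant_shift l hV iV.
have [n [C [cY hC]]] := semi_fredholm_core hV cV bG iG h.
exists n, C; split; first by case: hC.
by move=> e e0 he; rewrite -shiftD; apply: bij_shift_core hC e0 he.
Qed.

(** The ray of the [t * l] with [t >= 1] avoids 0, so every shift along it is Fredholm, and the far
    ones are bijective; [real_dichotomy] leads back to [t = 1]. One bijective shift close to [l]
    then settles a whole punctured disc. *)
Lemma riesz_bij l : l != 0 -> exists2 r : R, 0 < r &
  forall e, e != 0 -> md e < r -> bij V (shift F (l + e)).
Proof.
move=> l0; have ml := md_gt0 l0.
have [T T0 hT] := bij_shift_large hV cV bF iV.
pose b (t : R) := bij V (shift F (t%:C * l)).
have cor (t : R) : 1 <= t -> exists n C, 0 < C /\ forall s : R, s != t ->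
    `|s - t| < (8 * (C * md l))^-1 -> (b s <-> bij (rngM V (iter n (shift F (t%:C * l)))) (shift F (t%:C * l))).
  move=> t1; have tl : t%:C * l != 0.
    by rewrite mulf_neq0 // gt_eqF // gtc0E; lra.
  have [n [C [C0 h]]] := core (or_introl (hF tl).1).
  exists n, C; split=> // s st hs.
  have -> : b s = bij V (shift F (t%:C * l + (s - t)%:C * l)).
    by rewrite -mulrDl -rmorphD /= addrC subrK.
  apply: h; first by rewrite mulf_neq0 // fmorph_eq0 subr_eq0.
  have Cl : 0 < C * md l by rewrite mulr_gt0.
  rewrite mdM md_real mulrCA; apply: ltW.
  rewrite -ltr_pdivlMr //; apply: lt_le_trans hs _.
  by rewrite invfM mul1r.
have [||r r0 hr] := @real_dichotomy _ b (T / md l).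
- move=> t /cor [n [C [C0 h]]].
  exists (8 * (C * md l))^-1; first by rewrite invr_gt0 !mulr_gt0.
  have [hb|hb] := pselect (bij (rngM V (iter n (shift F (t%:C * l)))) (shift F (t%:C * l))).
    by left=> s st hs; apply/(h s st hs).
  by right=> s st hs /(h s st hs).
- move=> t hTt; apply: hT; rewrite mdM md_real -ltr_pdivrMr //.
  by apply: lt_le_trans hTt (ler_norm _).
have [n [C [C0 h]]] := core (or_introl (hF l0).1).
have C8 : 0 < (8 * C)^-1 by rewrite invr_gt0 mulr_gt0.
have hC8 e : md e <= (8 * C)^-1 -> C * md e <= 1 / 8.
  move=> he; have := ler_wpM2l (ltW C0) he.
  suff -> : C * (8 * C)^-1 = 1 / 8 by [].
  by field; rewrite gt_eqF.
exists (8 * C)^-1 => // e e0 he; apply/h => //; first by apply/hC8/ltW.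
have [q [q0 qr qC]] := pos_below r0 (divr_gt0 C8 ml).
apply/(h (q%:C * l)).
- by rewrite mulf_neq0 // fmorph_eq0 gt_eqF.
- by apply: hC8; rewrite mdM md_real gtr0_norm // -ler_pdivlMr.
have -> : l + q%:C * l = (1 + q)%:C * l by rewrite rmorphD /= mulrDl mul1r.
apply: hr; first by rewrite -subr_eq0 addrC addKr gt_eqF.
by rewrite addrC addKr gtr0_norm.
Qed.

Lemma riesz_core l : Phi_plus V (shift F l) \/ Phi_minus V (shift F l) ->
  exists n, bij (rngM V (iter n (shift F l))) (shift F l).
Proof.
move=> h; have [n [C [C0 hb]]] := core h; exists n.
have C8 : 0 < (16 * C)^-1 by rewrite invr_gt0 mulr_gt0.
have CE : C * (16 * C)^-1 = 1 / 16 by field; rewrite gt_eqF.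
have [l0|l0] := eqVneq l 0.
  (* [riesz_bij] excludes 0, so it is applied at a nearby [a]; it speaks of a punctured disc, hence
     the point [a + q%:C]. Taking 16 in place of 8 leaves room for [q]. *)
  pose a : R[i] := ((16 * C)^-1)%:C.
  have a0 : a != 0 by rewrite fmorph_eq0 gt_eqF.
  have [r r0 hr] := riesz_bij a0.
  have [q [q0 qr qC]] := pos_below r0 C8.
  apply/(hb (a + q%:C)).
  - by rewrite -rmorphD /= fmorph_eq0 gt_eqF // addr_gt0.
  - rewrite -rmorphD /= md_real gtr0_norm ?addr_gt0 // mulrDr CE.
    by have := ler_wpM2l (ltW C0) qC; rewrite CE; lra.
  rewrite l0 add0r; apply: hr; first by rewrite fmorph_eq0 gt_eqF.
  by rewrite md_real gtr0_norm.
have [r r0 hr] := riesz_bij l0.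
have [q [q0 qr qC]] := pos_below r0 C8.
apply/(hb q%:C); first by rewrite fmorph_eq0 gt_eqF.
  rewrite md_real gtr0_norm //.
  by have := ler_wpM2l (ltW C0) qC; rewrite CE; lra.
by apply: hr; rewrite ?fmorph_eq0 ?gt_eqF // md_real gtr0_norm.
Qed.

End Riesz.

(** The common value of nullity and deficiency is recorded so that [inclass_dsum] can add it to both
    without changing the index. *)
Definition browder0 V F : Prop := Browder V F /\
  exists n, codim_is (kerM V F) [set 0] n /\ codim_is V (rngM V F) n.

(** Bijectivity on [R(F^n)] bounds ascent and descent by [n]. For [index_zero_of_core] this range
    must have finite codimension: if only the kernel is known to be finite-dimensional, [N(F^n)]
    supplies a complement. *)
Lemma browder0_of_core V F n : is_subspace V -> closed V -> bop F -> invariant V F ->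
  bij (rngM V (iter n F)) F -> Phi_plus V F \/ Phi_minus V F -> browder0 V F.
Proof.
move=> hV cV bF iV [kY YF] hP; have lF := bF.1.
set Y := rngM V (iter n F) in kY YF.
have hY : is_subspace Y := subsp_rng_iter n lF hV.
have YV : Y `<=` V by move=> _ [x Vx <-]; apply: invariant_iter.
have iY : invariant Y F := rng_iter_inv iV.
have FY : F @` Y = Y by apply/seteqP; split=> // _ [x /iY Yx <-].
have FnY m : iter m F @` Y = Y.
  elim: m => [|m IH]; first by apply/seteqP; split=> [_ [x Yx <-]|x Yx] //; exists x.
  apply/seteqP; split=> [_ [x Yx <-]|x]; first exact: (invariant_iter _ iY).
  rewrite -{1}FY -{1}IH => -[_ [z Yz <-] <-]; by exists z.
have hasc : finite_ascent V F.
  exists n; apply/seteqP; split; first exact: ker_iter_sub.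
  move=> x [Vx /= hx]; split=> //=; apply: kY; split=> //; by exists x.
have hdesc : finite_descent V F.
  exists n; apply/seteqP; split; last exact: rng_iter_sub.
  by rewrite rng_iterS -/Y FY.
have [d hd] : exists d, codim_le V Y d.
  case: hP => [[/findimE [k hk] _]|[k hk]]; last exact: codim_rng_iter hk.
  have [d [s [sd hs]]] := dim_ker_iter hV bF iV n hk.
  exists d, s; split=> // x Vx.
  have : Y (iter n F x) by exists x.
  rewrite -{1}(FnY n) => -[y Yy yx].
  have [|a [v [-> [sv xy]]]] := hs (x - y).
    split; first by apply: subspB => //; apply: YV.
    by rewrite /= (linB _ _ (lin_iter n lF)) yx subrr.
  by exists y, v; split=> //; split=> //; rewrite -[x](subrK y) xy add0r addrC.
have kY' : kerM V F `&` Y `<=` [set 0] by move=> x [[Vx kx] Yx]; apply: kY.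
have [j [h1 h2]] := index_zero_of_core lF hV hY iV YV FY kY' hd.
split; last by exists j.
split=> //; split; last by exists j; apply: codim_is_le.
split; first by apply/findimE; exists j; apply: codim_is_le.
exact: (fincodim_range_closed bF hV cV hV cV iV (codim_is_le h2)).
Qed.

End RieszOperators.

(** * The nine classes *)

Section Classes.
Variable R : realType.
Variable X : completeNormedModType R[i].
Implicit Types (A B M N V W Q Z : set X) (x y z w : X) (F G S : X -> X) (C : R) (l : R[i]).

(** If [u = F^p x] is in [N(F)], then [x] is in [N(F^(p+1)) = N(F^p)], so [u = 0]. *)
Lemma kato_ascent V F : lin F -> is_subspace V ->
  (forall n, kerM V F `<=` rngM V (iter n F)) ->
  finite_ascent V F <-> kerM V F `<=` [set 0].
Proof.
move=> lF hV hK; split=> [[p hp] u ku|h].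
  have [x Vx xu] := hK p _ ku; have : kerM V (iter p.+1 F) x.
    by split=> //=; rewrite xu; case: ku.
  by rewrite -hp => -[_ /=]; rewrite xu.
exists 0%N; apply/seteqP; split=> [x [Vx /= ->]|x /h /= ->].
  by split; [exact: subsp0|exact: lin0].
by split; first exact: subsp0.
Qed.

(** If [F^q x = F^(q+1) z], then [x - F z] is in [N(F^q)], which lies in the hyper-range and so in
    [R(F)]. *)
Lemma kato_descent V F : lin F -> is_subspace V -> invariant V F ->
  (forall n, kerM V F `<=` rngM V (iter n F)) ->
  finite_descent V F <-> V `<=` rngM V F.
Proof.
move=> lF hV iV hK; split=> [[q hq] x Vx|h].
  have hyp j u : V u -> iter j F u = 0 -> hyperrange V F u.
    elim: j u => [u _ /= ->|j IH u Vu].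
      exact: subsp0 (subsp_hyperrange lF hV).
    rewrite iterSr => /IH h; apply: (@hyperrange_shift _ _ _ _ 0) => //.
    by rewrite shift0; apply: h; apply: iV.
  have : rngM V (iter q F) (iter q F x) by exists x.
  rewrite hq => -[z Vz hz]; rewrite -(subrK (F z) x).
  have hR : is_subspace (rngM V F) by apply: subsp_img.
  apply: subspD => //; last by exists z.
  apply: (hyp q _ _ _ 1%N); first by apply: subspB => //; apply: iV.
  by rewrite (linB _ _ (lin_iter q lF)) -hz iterSr subrr.
exists 0%N; apply/seteqP; split=> [_ [x /h Rx <-] //|_ [x Vx <-]].
by exists (F x) => //; apply: iV.
Qed.

Lemma codimn_eq V B V' B' : (forall k, codim_le V B k <-> codim_le V' B' k) ->
  codimn V B = codimn V' B'.
Proof.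
move=> h; rewrite /codimn; congr xget; apply/seteqP.
by split=> n [/h hn hmin]; split=> // k /h /hmin.
Qed.

(** For a Kato operator the range is closed, finite ascent means nullity 0 and finite descent means
    deficiency 0; nullity and deficiency thus decide every class. *)
Lemma inclass_kato c V F G : is_subspace V -> bop F -> bop G -> invariant V F -> invariant V G ->
  Kato V F -> Kato V G ->
  (forall k, (codim_le (kerM V F) [set 0] k <-> codim_le (kerM V G) [set 0] k) /\
     (codim_le V (rngM V F) k <-> codim_le V (rngM V G) k)) ->
  inclass c V F <-> inclass c V G.
Proof.
move=> hV [lF _] [lG _] iF iG [cF kF] [cG kG] h.
have hk k := (h k).1; have hr k := (h k).2.
have e1 : findim (kerM V F) <-> findim (kerM V G).
  by rewrite !findimE; split=> -[k /hk hd]; exists k.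
have e2 : fincodim V (rngM V F) <-> fincodim V (rngM V G).
  by split=> -[k /hr hd]; exists k.
have e3 : index V F = index V G.
  by rewrite /index !dimn_codimn (codimn_eq hk) (codimn_eq hr).
have e4 : finite_ascent V F <-> finite_ascent V G.
  by rewrite (kato_ascent lF hV kF) (kato_ascent lG hV kG) -!codim_le0.
have e5 : finite_descent V F <-> finite_descent V G.
  by rewrite (kato_descent lF hV iF kF) (kato_descent lG hV iG kG) -!codim_le0.
have e6 : Phi_plus V F <-> Phi_plus V G by rewrite /Phi_plus e1; tauto.
case: c => /=; rewrite /Browder_plus /Browder_minus /Browder /Weyl_plus /Weyl_minus /Weyl
  /Fredholm /Phi_minus ?e3; tauto.
Qed.

Lemma ker_stable V F p q : invariant V F -> lin F -> kerM V (iter p F) = kerM V (iter p.+1 F) ->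
  (p <= q)%N -> kerM V (iter q F) = kerM V (iter q.+1 F).
Proof.
move=> iV lF hp pq; apply/seteqP; split; first exact: ker_iter_sub.
move=> x [Vx /= hx]; split=> //=.
have : kerM V (iter p.+1 F) (iter (q - p) F x).
  by split; [exact: invariant_iter|rewrite /= -iterS -iterD addSn subnKC].
by rewrite -hp => -[_ /=]; rewrite -iterD subnKC.
Qed.

Lemma rng_stable V F p q : rngM V (iter p F) = rngM V (iter p.+1 F) ->
  (p <= q)%N -> rngM V (iter q F) = rngM V (iter q.+1 F).
Proof.
move=> hp pq; rewrite -(subnK pq); elim: (q - p)%N => [|n IH] //.
by rewrite addSn rng_iterS [in RHS]rng_iterS -IH.
Qed.

(** * Direct sums of invariant subspaces *)

Section DirectSum.
Variables (M N : set X) (S : X -> X).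
Hypotheses (hM : is_subspace M) (cM : closed M) (hN : is_subspace N) (cN : closed N).
Hypotheses (MN : M `&` N `<=` [set 0]) (MNT : addsp M N = setT).

Section Algebra.
Variable F : X -> X.
Hypotheses (lF : lin F) (iM : invariant M F) (iN : invariant N F).

Lemma ker_dsum : kerM setT F = addsp (kerM M F) (kerM N F).
Proof.
apply/seteqP; split=> [x [_ /= Fx]|_ [a [b [[_ /= Fa] [_ /= Fb] ->]]]]; last first.
  by split=> //=; rewrite (linD _ _ lF) Fa Fb addr0.
have [m [n [Mm Nn xE]]] : addsp M N x by rewrite MNT.
rewrite xE (linD _ _ lF) in Fx.
have Fmn : F m = - F n by apply/eqP; rewrite -subr_eq0 opprK Fx.
have Fm : F m = 0.
  by apply: MN; split; [exact: iM|rewrite Fmn; apply: subspN => //; apply: iN].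
exists m, n; split=> //; split=> //=.
by rewrite Fm add0r in Fx.
Qed.

Lemma rng_dsum : rngM setT F = addsp (rngM M F) (rngM N F).
Proof.
apply/seteqP; split=> [_ [x _ <-]|_ [_ [_ [[m Mm <-] [n Nn <-] ->]]]]; last first.
  by exists (m + n) => //; rewrite (linD _ _ lF).
have [m [n [Mm Nn ->]]] : addsp M N x by rewrite MNT.
by exists (F m), (F n); split; [exists m|exists n|rewrite (linD _ _ lF)].
Qed.

(** Through these equations closedness and stabilisation of ranges pass from the whole space to a
    summand. *)
Lemma rng_dsum_cap : (rngM M F = M `&` rngM setT F) /\ (rngM N F = N `&` rngM setT F).
Proof.
split; apply/seteqP; split.
- by move=> _ [x Mx <-]; split; [exact: iM|exists x].
- rewrite rng_dsum => x [Mx [_ [_ [[m Mm <-] [n Nn <-] xE]]]].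
  exists m => //; have -> : x = F m + F n by [].
  suff -> : F n = 0 by rewrite addr0.
  apply: MN; split; last exact: iN.
  have -> : F n = x - F m by rewrite xE addrAC subrr add0r.
  by apply: subspB => //; apply: iM.
- by move=> _ [x Nx <-]; split; [exact: iN|exists x].
- rewrite rng_dsum => x [Nx [_ [_ [[m Mm <-] [n Nn <-] xE]]]].
  exists n => //; rewrite xE.
  suff -> : F m = 0 by rewrite add0r.
  apply: MN; split; first exact: iM.
  have -> : F m = x - F n by rewrite xE addrK.
  by apply: subspB => //; apply: iN.
Qed.

End Algebra.

Hypotheses (bS : bop S) (iM : invariant M S) (iN : invariant N S).
Let lS := bS.1.

Let sub0 : [set (0 : X)] = addsp [set 0] [set 0].
Proof.
apply/seteqP; split=> [_ ->|_ [a [b [-> -> ->]]]]; rewrite ?addr0 //.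
by exists 0, 0; rewrite addr0.
Qed.

Let rngV V : invariant V S -> rngM V S `<=` V.
Proof. by move=> iV _ [x /iV Vx <-]. Qed.

Lemma phi_restrict : Phi_plus setT S \/ Phi_minus setT S -> Phi_plus N S \/ Phi_minus N S.
Proof.
case=> [[[k [s [sk hs]]] cR]|[k hk]]; [left|right].
  split; first by exists k, s; split=> // x [_ kx]; apply: hs.
  by rewrite (rng_dsum_cap lS iM iN).2; apply: closedI.
exists k; have hRM := subsp_img lS hM; have hRN := subsp_img lS hN.
by have [] := codim_le_dsum hM hN hRM hRN (rngV iM) (rngV iN) MN (esym MNT) (rng_dsum lS) hk.
Qed.

(** The summand [N] adds the same [j] to nullity and deficiency, and its range is closed and its
    ascent and descent finite, so no class condition changes. *)
Lemma inclass_dsum c : browder0 N S -> inclass c setT S <-> inclass c M S.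
Proof.
move=> [[[[_ cRN] _] [[p hp] [q hq]]] [j [kj rj]]].
have hRM : is_subspace (rngM M S) := subsp_img lS hM.
have hRN : is_subspace (rngM N S) := subsp_img lS hN.
have hKM := subsp_ker lS hM; have hKN := subsp_ker lS hN.
have s0 := @subsp_set0 _ X.
have z0 W : is_subspace W -> [set 0] `<=` W by move=> hW _ ->; apply: subsp0.
have KMN : kerM M S `&` kerM N S `<=` [set 0] by move=> x [[? _] [? _]]; apply: MN.
have kD n : codim_is (kerM M S) [set 0] n -> codim_is (kerM setT S) [set 0] (n + j).
  by move=> hn; apply: (codim_is_dsum hKM hKN s0 s0 _ _ KMN (ker_dsum lS iM iN) sub0 hn kj);
    apply: z0.
have rD n : codim_is M (rngM M S) n -> codim_is setT (rngM setT S) (n + j).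
  by move=> hn; apply: (codim_is_dsum hM hN hRM hRN (rngV iM) (rngV iN) MN (esym MNT)
    (rng_dsum lS) hn rj).
have e1 : findim (kerM setT S) <-> findim (kerM M S).
  rewrite !findimE; split=> [[k hk]|[k /codim_is_exists [n /kD hn]]]; last first.
    by exists (n + j)%N; apply: codim_is_le.
  exists k; have [] // := codim_le_dsum hKM hKN s0 s0 (z0 _ hKM) (z0 _ hKN) KMN (ker_dsum lS iM iN) sub0 hk.
have e2 : fincodim setT (rngM setT S) <-> fincodim M (rngM M S).
  split=> [[k hk]|[k /codim_is_exists [n /rD hn]]]; last first.
    by exists (n + j)%N; apply: codim_is_le.
  exists k; by have [] := codim_le_dsum hM hN hRM hRN (rngV iM) (rngV iN) MN (esym MNT) (rng_dsum lS) hk.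
(* Both finiteness conditions are required, as [dimn] and [codimn] otherwise default to 0. *)
have e3 : findim (kerM M S) -> fincodim M (rngM M S) -> index setT S = index M S.
  rewrite findimE => -[k /codim_is_exists [n hn]] [k' /codim_is_exists [n' hn']].
  rewrite /index !dimn_codimn (codimnE hn) (codimnE hn') (codimnE (kD _ hn)) (codimnE (rD _ hn')).
  by rewrite !PoszD opprD addrACA subrr addr0.
have e4 : closed (rngM setT S) <-> closed (rngM M S).
  split=> h; first by rewrite (rng_dsum_cap lS iM iN).1; apply: closedI.
  rewrite (rng_dsum lS).
  exact: (closed_dsum hM cM hN cN MN MNT hRM hRN (rngV iM) (rngV iN) h cRN).
have e5 : finite_ascent setT S <-> finite_ascent M S.
  split=> -[r hr].
    exists r; have kE n : kerM M (iter n S) = M `&` kerM setT (iter n S).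
      by apply/seteqP; split=> x; [case|case=> ? []].
    by rewrite !kE hr.
  exists (maxn p r); rewrite !(ker_dsum (lin_iter _ lS) (invariant_iter _ iM) (invariant_iter _ iN)).
  by rewrite (ker_stable iM lS hr (leq_maxr _ _)) (ker_stable iN lS hp (leq_maxl _ _)).
have e6 : finite_descent setT S <-> finite_descent M S.
  split=> -[r hr].
    exists r; rewrite (rng_dsum_cap (lin_iter r lS) (invariant_iter _ iM) (invariant_iter _ iN)).1.
    by rewrite (rng_dsum_cap (lin_iter r.+1 lS) (invariant_iter _ iM) (invariant_iter _ iN)).1 hr.
  exists (maxn q r); rewrite !(rng_dsum (lin_iter _ lS)).
  by rewrite (rng_stable hr (leq_maxr _ _)) (rng_stable hq (leq_maxl _ _)).
have e7 : Phi_plus setT S <-> Phi_plus M S by rewrite /Phi_plus e1 e4.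
case: c => /=; rewrite /Browder_plus /Browder_minus /Browder /Weyl_plus /Weyl_minus /Weyl
  /Fredholm /Phi_minus ?e7 ?e2 ?e5 ?e6 ?e1 //.
- by split=> -[h1 h2]; split=> // h3; move: (h2 h3); rewrite e3 //; case: h1.
- by split=> -[h1 h2]; split=> // h3; move: (h2 h3); rewrite e3 //; case: h1.
- by split=> -[[h1 h3] h2]; split=> //; move: h2; rewrite e3 //; case: h1.
Qed.

End DirectSum.

Lemma semi_of_inclass c V F : inclass c V F -> Phi_plus V F \/ Phi_minus V F.
Proof.
by case: c => /=; [case|case|case=> -[]| | |case|case|case|case=> -[]]; auto.
Qed.

(** The radius depends only on the Kato constant on [M], since on [N] every shift with [l != 0] is
    Browder of index 0; it therefore serves all classes. At [l0 = 0] the membership itself makes [S]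
    semi-Fredholm on [N]. *)
Lemma inclass_punctured (S : X -> X) M N : bop S -> is_subspace M -> is_subspace N ->
  closed M -> closed N -> invariant M S -> invariant N S -> M `&` N = [set 0] ->
  (forall x : X, exists m y, M m /\ N y /\ x = m + y) -> Kato M S -> Riesz N S ->
  exists2 r : R, 0 < r & forall c l0 l, md l0 < r -> inclass c setT (shift S l0) ->
    l != 0 -> md l < r -> inclass c setT (shift S l).
Proof.
move=> bS hM hN cM cN iM iN MN0 MNx KM RN.
have MN : M `&` N `<=` [set 0] by rewrite MN0.
have MNT : addsp M N = setT.
  by apply/seteqP; split=> // x _; have [m [y [? [? ?]]]] := MNx x; exists m, y.
have [C hC] := (KatoP bS hM cM).1 KM; have C0 : 0 < C by case: hC.
exists (8 * C)^-1; first by rewrite invr_gt0 mulr_gt0.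
have hC8 l : md l < (8 * C)^-1 -> C * md l <= 1 / 8.
  move=> he; have := ler_wpM2l (ltW C0) (ltW he).
  suff -> : C * (8 * C)^-1 = 1 / 8 by [].
  by field; rewrite gt_eqF.
move=> c l0 l /hC8 hl0 h l_neq0 /hC8 hl.
have good e : Phi_plus N (shift S e) \/ Phi_minus N (shift S e) -> browder0 N (shift S e).
  move=> hP; have [n hn] := riesz_core hN cN bS iN RN hP.
  apply: browder0_of_core hn hP => //; first exact: bop_shift.
  exact: invariant_shift.
have dsum e : browder0 N (shift S e) -> inclass c setT (shift S e) <-> inclass c M (shift S e).
  move=> hb; apply: (inclass_dsum hM cM hN cN MN MNT (bop_shift e bS)) => //;
  exact: invariant_shift.
have kato e : C * md e <= 1 / 8 -> inclass c M S <-> inclass c M (shift S e).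
  move=> he; apply: inclass_kato => //.
  - exact: bop_shift.
  - exact: invariant_shift.
  - by apply/(KatoP (bop_shift e bS) hM cM); exists (5 * C); apply: kato_bound_shift.
  - exact: kato_stable he.
apply/(dsum l (good _ (or_introl (RN l l_neq0).1)))/(kato l hl)/(kato l0 hl0)/dsum => //.
apply: good; apply: (@phi_restrict M N) (semi_of_inclass h) => //.
- exact: bop_shift.
- exact: invariant_shift.
- exact: invariant_shift.
Qed.

End Classes.

(** * Boundary points at which the spectra accumulate *)

Theorem theorem3p15 (R : realType) (X : completeNormedModType R[i])
    (T : {linear X -> X}) :
  infinite_dimensional X -> continuous T ->
  (forall c : opclass,
     boundary (sigma_cls c T) `&` limit_point (sigma_cls c T)
       `<=` sigma_gKR T) /\
  boundary (sigma_ap T) `&` limit_point (sigma_cls cB_plus T) `<=` sigma_gKR T /\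
  boundary (sigma_su T) `&` limit_point (sigma_cls cB_minus T) `<=` sigma_gKR T /\
  boundary (spectrum T) `&` limit_point (sigma_cls cB T) `<=` sigma_gKR T.
Proof.
move=> _ cT.
have bT : bop T.
  split; last exact: continuous_bounded.
  by split=> [x y|a x]; rewrite ?linearD ?linearZ.
(* The boundary belongs to the failure set of [P], the accumulation to the class [c]. Taking [P] to
   be the class gives the nine inclusions; bounded below, surjective and invertible give the other
   three. *)
have key c (P : (X -> X) -> Prop) :
    (forall l, P (shift T l) -> inclass c setT (shift T l)) ->
    boundary [set l | ~ P (shift T l)] `&` limit_point (sigma_cls c T) `<=` sigma_gKR T.
  move=> hP l [[_ hi] hl] [M [N [hM [hN [cM [cN [iM [iN [MN [MNx [KM RN]]]]]]]]]]].
  have [r r0 hr] := inclass_punctured (bop_shift l bT) hM hN cM cN iM iN MN MNx KM RN.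
  (* Since [l] is not interior, [P] holds at some [l1] near [l], possibly at [l] itself. *)
  have [l1 hl1 Pl1] : exists2 l1, md (l1 - l) < r & P (shift T l1).
    apply: contrapT => hno; apply: hi; apply/nbhs_mdP; exists r => // y hy Py.
    by apply: hno; exists y.
  have [|y [yl hy yr]] := hl [set y | md (y - l) < r].
    by apply/nbhs_mdP; exists r.
  apply: hy; have := hr c (l1 - l) (y - l) hl1.
  by rewrite !shiftD ![l + _]addrC !subrK subr_eq0; apply => //; apply: hP.
have linT l : lin (shift T l) := lin_shift l bT.1.
have asc0 l : (forall x, shift T l x = 0 -> x = 0) -> finite_ascent setT (shift T l) /\
    findim (kerM setT (shift T l)).
  move=> h; split; last by apply/findimE; exists 0%N; apply/codim_le0 => x [_ /h].
  exists 0%N; apply/seteqP; split=> x [_ /= hx]; split=> //=; last exact: h.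
  by rewrite hx; apply: lin0.
have desc0 l : (forall y, exists x, shift T l x = y) -> finite_descent setT (shift T l) /\
    Phi_minus setT (shift T l).
  move=> h; split.
    exists 0%N; apply/seteqP; split=> y _; last by exists y.
    by have [x xy] := h y; exists x.
  by exists 0%N; apply/codim_le0 => y _; have [x xy] := h y; exists x.
split; [|split; [|split]].
- by move=> c; apply: (key c (inclass c setT)).
- apply: (key cB_plus (@bounded_below _ _)) => l [c [/gtc0_real [-> c0] hc]].
  have hc' x : nrm x <= (complex.Re c)^-1 * nrm (shift T l x).
    rewrite mulrC ler_pdivlMr // mulrC -lecR rmorphM /= -!nrmE; exact: hc.
  have [|h1 h2] := asc0 l.
    move=> x hx; apply: nrm_eq0; apply/eqP; rewrite eq_le nrm_ge0 andbT.
    by have := hc' x; rewrite hx nrm0 mulr0.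
  split=> //; split=> //.
  apply: (range_bound_closed (bop_shift l bT) (@subsp_setT _ _) closedT (_ : 0 < (complex.Re c)^-1)).
    by rewrite invr_gt0.
  by move=> x _; exists x.
- apply: (key cB_minus (fun F => forall y, exists x, F x = y)) => l /desc0 [h1 h2].
  by split.
- apply: (key cB (@invertible _ _)) => l [U [_ [US SU]]].
  have [|a1 a2] := asc0 l.
    by move=> x hx; rewrite -(US x) hx -[X in U X](lin0 (linT l)) US.
  have [|d1 d2] := desc0 l; first by move=> y; exists (U y).
  split=> //; split=> //; split=> //.
  suff -> : rngM setT (shift T l) = setT by exact: closedT.
  by apply/seteqP; split=> // y _; exists (U y).
Qed.
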